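(* Let $X$ be a compact tame space. The map $\boldsymbol\Xi:\mathbf{Fl}_{\mathrm{grad}}(X)\to\mathcal C_w(X)$, $\Phi\mapsto\boldsymbol\Xi_\Phi$, which associates to a gradient-like tame flow on $X$ with finitely many stationary points (together with a Lyapunov function) its weighted chain of tame flips, is surjective. That is, every weighted chain of tame flips whose associated space is $X$ is the weighted chain of some gradient-like tame flow on $X$ with finitely many stationary points, relative to some Lyapunov function of that flow.
   Context: **Tame.** A structure is a collection $\mathcal S=(\mathcal S^n)_{n\ge1}$, $\mathcal S^n$ a family of subsets of $\mathbb R^n$, containing all real algebraic subvarieties and all half-spaces $\{L\ge0\}$, closed under Boolean operations, products and images under affine maps. $\mathcal S_{an}$ is the structure of globally subanalytic sets, and $\widehat{\mathcal S}_{an}$ the smallest structure containing it such that: if $U\subset\mathbb R^n$ is open, connected, definable, $F_1,\dots,F_n:U\times\mathbb R\to\mathbb R$ are definable and $C^1$, and $f:U\to\mathbb R$ is $C^1$ with $\partial f/\partial x_i=F_i(x,f(x))$, then $f$ is definable (known to be o-minimal). Sets in $\widehat{\mathcal S}_{an}$, and maps whose graphs are in it, are called tame. Spaces built by gluing (mapping cylinders etc.) are tame spaces via tame quotients, and are identified up to tame homeomorphism. A tame flow is a continuous flow that is a tame map. A Lyapunov function for $\Phi$ is a tame continuous function strictly decreasing along nonconstant trajectories and constant on path components of the stationary set $\mathrm{Cr}_\Phi$; $\Phi$ is gradient-like if it admits one. $\mathbf{Fl}_{\mathrm{grad}}(X)$ is the set of gradient-like tame flows on $X$ with finitely many stationary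 points. **Blowdowns, weights.** A tame blowdown is a continuous tame map $\beta:Y\to X$ of compact tame sets together with a finite nonempty set $L_\beta\subset X$ (blowup locus) such that $\beta:Y\setminus\beta^{-1}(L_\beta)\to X\setminus L_\beta$ is a homeomorphism ($\beta^{-1}(L_\beta)=\emptyset$ is allowed). A weight for $\beta$ is a tame continuous $w:X\to[0,\infty)$ with $w^{-1}(0)=L_\beta$. **Weighted chains.** A weighted chain of tame flips is a sequence of tame blowdowns $$Y_{-1}\xrightarrow{\rho_0}X_0\xleftarrow{\lambda_0}Y_1\xrightarrow{\rho_1}X_1\xleftarrow{\lambda_1}Y_2\cdots Y_n\xrightarrow{\rho_n}X_n\xleftarrow{\lambda_n}Y_{n+1}$$ with $X_0,X_n$ finite, $Y_{-1}=Y_{n+1}=\emptyset$, $L_{\rho_i}=L_{\lambda_i}$ for all $i$, together with weights $w_i^+$ for $\rho_i$ and $w_i^-$ for $\lambda_i$. Its associated space is $\mathrm{Cyl}_{\lambda_0}\cup_{Y_1}\mathrm{Cyl}_{\rho_1}\cup_{X_1}\mathrm{Cyl}_{\lambda_1}\cup_{Y_2}\cdots\cup_{Y_n}\mathrm{Cyl}_{\rho_n}$, where $\mathrm{Cyl}_g$ is the mapping cylinder of $g$. $\mathcal C_w(X)$ is the set of weighted chains whose associated space is $X$. **The chain of a flow.** Let $\Phi\in\mathbf{Fl}_{\mathrm{grad}}(X)$, fix a Lyapunov function $f$, let $f(\mathrm{Cr}_\Phi)=\{c_0<\dots<c_n\}$, $d_i=\frac{c_{i-1}+c_i}2$ for $1\le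 i\le n$, $Y_i=\{f=d_i\}$ for $1\le i\le n$, $X_j=\{f=c_j\}$ for $0\le j\le n$. Define $\lambda_i:Y_{i+1}\to X_i$ and $\rho_i:Y_i\to X_i$ by letting the image of $y$ be the point where the trajectory of $y$ (or its closure, i.e. the limit stationary point on $X_i$ if the trajectory itself does not meet $X_i$) meets $X_i$. These are tame blowdowns with blowup locus $\mathrm{Cr}_\Phi\cap X_i$. For $x\in X_i$ put $T_i^+(x)=\sup\{t>0:f(\Phi_t(x))\ge d_i\}$, $T_i^-(x)=\sup\{t>0:f(\Phi_{-t}(x))\le d_{i+1}\}$ in $(0,\infty]$, and $w_i^\pm=1/T_i^\pm$ (with $1/\infty=0$; for $X_0$, resp. $X_n$, which consist of stationary points only, $w_0^+=0$, resp. $w_n^-=0$). $\boldsymbol\Xi_\Phi$ is the resulting weighted chain. *)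

(* Defs.v *)
From HB Require Import structures.
From mathcomp Require Import all_boot all_order all_algebra.
From mathcomp Require Import all_classical all_reals all_analysis.
From mathcomp Require mpoly.
From Stdlib Require Relations.Relation_Operators.

Set Implicit Arguments.
Unset Strict Implicit.
Unset Printing Implicit Defensive.

Import Order.TTheory GRing.Theory Num.Theory.
Import numFieldNormedType.Exports.
Local Open Scope classical_set_scope.
Local Open Scope ring_scope.

(* R^n is 'rV[R]_n, and R^n x R^m is identified with R^(n + m) by row_mx. *)

Section Tame.
Variable R : realType.

Definition prod_set n m (A : set 'rV[R]_n) (B : set 'rV[R]_m)
  : set 'rV[R]_(n + m) := [set z | A (lsubmx z) /\ B (rsubmx z)].

Definition graph n m (A : set 'rV[R]_n) (f : 'rV[R]_n -> 'rV[R]_m)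
  : set 'rV[R]_(n + m) := [set row_mx x (f x) | x in A].

Definition graph1 n (A : set 'rV[R]_n) (f : 'rV[R]_n -> R) : set 'rV[R]_(n + 1) :=
  graph A (fun x => const_mx (f x)).

Definition sets_of_Rn := forall n : nat, set (set 'rV[R]_n).

(* The index n = 0 is allowed: R^0 is a point, and a structure indexed by
   n >= 1 extends to n = 0 in exactly one way, by {set0, R^0}. *)
Record is_structure (S : sets_of_Rn) : Prop := {
  structure_algebraic n k (ps : 'I_k -> mpoly.mpoly n R) :
    S n [set x | forall j, mpoly.meval (fun i => x ord0 i) (ps j) = 0];
  structure_halfspace n (a : 'I_n -> R) (b : R) :
    S n [set x | 0 <= \sum_i a i * x ord0 i + b];
  structure_setU n (A B : set 'rV[R]_n) : S n A -> S n B -> S n (A `|` B);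
  structure_setI n (A B : set 'rV[R]_n) : S n A -> S n B -> S n (A `&` B);
  structure_setC n (A : set 'rV[R]_n) : S n A -> S n (~` A);
  structure_prod n m (A : set 'rV[R]_n) (B : set 'rV[R]_m) :
    S n A -> S m B -> S (n + m)%N (prod_set A B);
  structure_affine n m (M : 'M[R]_(n, m)) (b : 'rV[R]_m) (A : set 'rV[R]_n) :
    S n A -> S m [set x *m M + b | x in A]
}.

(* Sum, as an absolutely convergent power series with coefficients c, on a
   neighbourhood of a; the partial sums run over multi-indices in [0, N)^n. *)
Definition analytic_at n (f : 'rV[R]_n -> R) (a : 'rV[R]_n) : Prop :=
  exists c : ('I_n -> nat) -> R,
    let term (x : 'rV[R]_n) (al : 'I_n -> nat) : R :=
      c al * \prod_(i < n) (x ord0 i - a ord0 i) ^+ al i in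
    exists2 r : R, 0 < r & forall x, ball a r x ->
      (exists M : R, forall N : nat,
        \sum_(al : {ffun 'I_n -> 'I_N}) `|term x (fun i => al i)| <= M) /\
      (fun N : nat => \sum_(al : {ffun 'I_n -> 'I_N}) term x (fun i => al i))
        @ \oo --> f x.

Definition cube n : set 'rV[R]_n := [set x | forall i, -1 <= x ord0 i <= 1].

Definition restricted_analytic n (f : 'rV[R]_n -> R) : Prop :=
  exists (U : set 'rV[R]_n) (g : 'rV[R]_n -> R),
    [/\ open U, @cube n `<=` U, forall x, U x -> analytic_at g x,
        forall x, @cube n x -> f x = g x & forall x, ~ @cube n x -> f x = 0].

(* Globally subanalytic sets, as the smallest structure containing the graphs
   of restricted analytic functions (Gabrielov, van den Dries-Miller). *)
Definition S_an : sets_of_Rn := fun n => [set A |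
  forall S : sets_of_Rn, is_structure S ->
    (forall m (f : 'rV[R]_m -> R),
       restricted_analytic f -> S (m + 1)%N (graph1 setT f)) ->
    S n A].

Definition coord_vec n (i : 'I_n) : 'rV[R]_n := delta_mx ord0 i.

Definition C1_on n (U : set 'rV[R]_n) (f : 'rV[R]_n -> R) : Prop :=
  forall i : 'I_n, (forall x, U x -> derivable f x (coord_vec i)) /\
    {within U, continuous (fun x => 'D_(coord_vec i) f x)}.

(* Functions on U and on U x R are given by total functions, of which only the
   restrictions to the open sets U and U x R matter. *)
Definition pfaff_closed (S : sets_of_Rn) : Prop :=
  forall n (U : set 'rV[R]_n) (F : 'I_n -> 'rV[R]_(n + 1) -> R)
      (f : 'rV[R]_n -> R),
    open U -> connected U -> S n U ->
    (forall i, S (n + 1 + 1)%N (graph1 (prod_set U setT) (F i))) ->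
    (forall i, C1_on (prod_set U setT) (F i)) ->
    C1_on U f ->
    (forall i x, U x ->
       'D_(coord_vec i) f x = F i (row_mx x (const_mx (f x)))) ->
    S (n + 1)%N (graph1 U f).

Definition tame n (A : set 'rV[R]_n) : Prop :=
  forall S : sets_of_Rn, is_structure S -> (forall m, @S_an m `<=` S m) ->
    pfaff_closed S -> S n A.

Definition tame_cont n m (A : set 'rV[R]_n) (B : set 'rV[R]_m)
    (f : 'rV[R]_n -> 'rV[R]_m) : Prop :=
  [/\ forall x, A x -> B (f x), {within A, continuous f} & tame (graph A f)].

Definition tame_cont1 n (A : set 'rV[R]_n) (f : 'rV[R]_n -> R) : Prop :=
  {within A, continuous f} /\ tame (graph1 A f).

Definition homeo_on n m (A : set 'rV[R]_n) (B : set 'rV[R]_m)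
    (f : 'rV[R]_n -> 'rV[R]_m) : Prop :=
  [/\ set_bij A B f, {within A, continuous f} &
    exists2 g : 'rV[R]_m -> 'rV[R]_n,
      forall x, A x -> g (f x) = x & {within B, continuous g}].

Definition tame_homeo n m (A : set 'rV[R]_n) (B : set 'rV[R]_m)
    (f : 'rV[R]_n -> 'rV[R]_m) : Prop :=
  tame_cont A B f /\ homeo_on A B f.

End Tame.

Section Chains.
Variable R : realType.

Definition blowdown n m (Y : set 'rV[R]_n) (X : set 'rV[R]_m)
    (beta : 'rV[R]_n -> 'rV[R]_m) (L : set 'rV[R]_m) : Prop :=
  [/\ compact Y /\ tame Y, compact X /\ tame X, tame_cont Y X beta,
      [/\ finite_set L, L !=set0 & L `<=` X] &
      homeo_on (Y `\` beta @^-1` L) (X `\` L) beta].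

Definition weight m (X L : set 'rV[R]_m) (w : 'rV[R]_m -> R) : Prop :=
  [/\ tame_cont1 X w, forall x, X x -> 0 <= w x &
      forall x, X x -> (w x = 0 <-> L x)].

(* The data  Y_0 -rho_0-> X_0 <-lam_0- Y_1 -rho_1-> ... X_n <-lam_n- Y_(n+1)
   with n = len; the empty space traditionally called Y_(-1) is Y_0 here.
   loc i is the common blowup locus of rho_i and lam_i.  Values at indices
   outside this range are irrelevant. *)
Record chain (R : realType) := Chain {
  len : nat;
  ydim : nat -> nat;
  xdim : nat -> nat;
  Ysp : forall i, set 'rV[R]_(ydim i);
  Xsp : forall i, set 'rV[R]_(xdim i);
  rho : forall i, 'rV[R]_(ydim i) -> 'rV[R]_(xdim i);
  lam : forall i, 'rV[R]_(ydim i.+1) -> 'rV[R]_(xdim i);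
  loc : forall i, set 'rV[R]_(xdim i);
  wplus : forall i, 'rV[R]_(xdim i) -> R;
  wminus : forall i, 'rV[R]_(xdim i) -> R
}.
Arguments Ysp {R} c i _.
Arguments Xsp {R} c i _.
Arguments loc {R} c i _.
Arguments rho {R} c i _.
Arguments lam {R} c i _.
Arguments wplus {R} c i _.
Arguments wminus {R} c i _.

Definition weighted_chain (C : chain R) : Prop :=
  [/\ finite_set (Xsp C 0) /\ finite_set (Xsp C (len C)),
      Ysp C 0 = set0 /\ Ysp C (len C).+1 = set0 &
      forall i, (i <= len C)%N ->
        [/\ blowdown (Ysp C i) (Xsp C i) (rho C i) (loc C i),
            blowdown (Ysp C i.+1) (Xsp C i) (lam C i) (loc C i),
            weight (Xsp C i) (loc C i) (wplus C i) &
            weight (Xsp C i) (loc C i) (wminus C i)]].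

Section AssociatedSpace.
Variable C : chain R.

(* Disjoint union of the X_i and of the Y x [0, 1] from which the cylinders of
   the lam_i and rho_i are glued; Cyl_g is Y x [0, 1] with (y, 1) ~ g y. *)
Inductive glue_point :=
| Base (i : nat) of 'rV[R]_(xdim C i)
| CylLam (i : nat) of 'rV[R]_(ydim C i.+1) & R
| CylRho (i : nat) of 'rV[R]_(ydim C i) & R.

Definition glue_dom : set glue_point := fun p =>
  match p with
  | Base i x => (i <= len C)%N /\ Xsp C i x
  | CylLam i y t => [/\ (i <= len C)%N, Ysp C i.+1 y & 0 <= t <= 1]
  | CylRho i y t => [/\ (i <= len C)%N, Ysp C i y & 0 <= t <= 1]
  end.

Inductive glue : glue_point -> glue_point -> Prop :=
| glue_lam i y : (i <= len C)%N -> Ysp C i.+1 y ->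
    glue (@CylLam i y 1) (@Base i (lam C i y))
| glue_rho i y : (i <= len C)%N -> Ysp C i y ->
    glue (@CylRho i y 1) (@Base i (rho C i y))
| glue_mid i y : (i < len C)%N -> Ysp C i.+1 y ->
    glue (@CylLam i y 0) (@CylRho i.+1 y 0).

Definition cyl n (Y : set 'rV[R]_n) : set 'rV[R]_(n + 1) :=
  prod_set Y [set t : 'rV[R]_1 | 0 <= t ord0 ord0 <= 1].

(* q presents the subset X of R^N as the tame quotient of the disjoint union
   by the equivalence relation generated by glue.  Cyl_(rho_0) and
   Cyl_(lam_n) are X_0 and X_n because Y_0 and Y_(n+1) are empty. *)
Definition associated_space N (X : set 'rV[R]_N) (q : glue_point -> 'rV[R]_N)
    : Prop :=
  [/\ q @` glue_dom = X,
      forall p p', glue_dom p -> glue_dom p' ->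
        (q p = q p' <-> Relation_Operators.clos_refl_sym_trans _ glue p p') &
      forall i, (i <= len C)%N ->
        [/\ tame_cont (Xsp C i) X (fun x => q (@Base i x)),
            tame_cont (cyl (Ysp C i.+1)) X
              (fun z => q (@CylLam i (lsubmx z) (rsubmx z ord0 ord0))) &
            tame_cont (cyl (Ysp C i)) X
              (fun z => q (@CylRho i (lsubmx z) (rsubmx z ord0 ord0)))]].

End AssociatedSpace.

Definition chain_iso (C C' : chain R)
    (hX : forall i, 'rV[R]_(xdim C i) -> 'rV[R]_(xdim C' i))
    (hY : forall i, 'rV[R]_(ydim C i) -> 'rV[R]_(ydim C' i)) : Prop :=
  [/\ len C = len C',
      forall i, (i <= (len C).+1)%N -> tame_homeo (Ysp C i) (Ysp C' i) (hY i) &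
      forall i, (i <= len C)%N ->
        [/\ tame_homeo (Xsp C i) (Xsp C' i) (hX i),
            hX i @` loc C i = loc C' i,
            forall y, Ysp C i y -> hX i (rho C i y) = rho C' i (hY i y),
            forall y, Ysp C i.+1 y -> hX i (lam C i y) = lam C' i (hY i.+1 y) &
            forall x, Xsp C i x ->
              wplus C' i (hX i x) = wplus C i x /\ wminus C' i (hX i x) = wminus C i x]].

End Chains.

Section Flows.
Variables (R : realType) (N : nat) (X : set 'rV[R]_N).
Variable Phi : R -> 'rV[R]_N -> 'rV[R]_N.

Definition tame_flow : Prop :=
  [/\ tame_cont (prod_set [set: 'rV[R]_1] X) X
        (fun z => Phi (lsubmx z ord0 ord0) (rsubmx z)),
      forall x, X x -> Phi 0 x = x &
      forall s t x, X x -> Phi (s + t) x = Phi s (Phi t x)].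

Definition Cr : set 'rV[R]_N := [set x | X x /\ forall t, Phi t x = x].

Definition lyapunov (f : 'rV[R]_N -> R) : Prop :=
  [/\ tame_cont1 X f,
      forall x, X x -> (exists t, Phi t x <> x) ->
        forall s t, s < t -> f (Phi t x) < f (Phi s x) &
      forall gam : R -> 'rV[R]_N,
        {within `[0, 1], continuous gam} ->
        (forall t, 0 <= t <= 1 -> Cr (gam t)) -> f (gam 0) = f (gam 1)].

Definition Fl_grad : Prop :=
  [/\ tame_flow, exists f, lyapunov f & finite_set Cr].

Section ChainOfFlow.
Variables (f : 'rV[R]_N -> R) (n : nat) (c : nat -> R).

Definition critical_levels : Prop :=
  (forall i j, (i < j <= n)%N -> c i < c j) /\
  f @` Cr = [set c i | i in [set i | (i <= n)%N]].

Definition dlevel (i : nat) : R := (c i.-1 + c i) / 2.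

Definition Xlevel (i : nat) : set 'rV[R]_N := [set x | X x /\ f x = c i].

Definition Ylevel (i : nat) : set 'rV[R]_N :=
  if (0 < i <= n)%N then [set x | X x /\ f x = dlevel i] else set0.

Definition orbit (y : 'rV[R]_N) : set 'rV[R]_N := range (fun t => Phi t y).

Definition meets_at (i : nat) (y x : 'rV[R]_N) : Prop :=
  Xlevel i x /\
  (orbit y x \/ (orbit y `&` Xlevel i = set0 /\ closure (orbit y) x)).

Definition level_proj (i : nat) (y : 'rV[R]_N) : 'rV[R]_N :=
  xget 0 [set x | meets_at i y x].

Definition Tplus (i : nat) (x : 'rV[R]_N) : \bar R :=
  ereal_sup [set t%:E | t in [set t : R | 0 < t /\ dlevel i <= f (Phi t x)]].

Definition Tminus (i : nat) (x : 'rV[R]_N) : \bar R :=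
  ereal_sup
    [set t%:E | t in [set t : R | 0 < t /\ f (Phi (- t) x) <= dlevel i.+1]].

(* The inverse of \bar R satisfies (+oo)^-1 = 0. *)
Definition flow_wplus (i : nat) (x : 'rV[R]_N) : R :=
  if i == 0%N then 0 else fine ((Tplus i x)^-1)%E.

Definition flow_wminus (i : nat) (x : 'rV[R]_N) : R :=
  if i == n then 0 else fine ((Tminus i x)^-1)%E.

Definition flow_chain : chain R :=
  @Chain R n (fun _ => N) (fun _ => N) Ylevel Xlevel level_proj level_proj
    (fun i => Cr `&` Xlevel i) flow_wplus flow_wminus.

End ChainOfFlow.
End Flows.

(* Main.v *)
Require Import Defs.
From mathcomp Require Import all_boot all_order all_algebra.
From mathcomp Require Import all_classical all_reals all_analysis.
From mathcomp Require mpoly.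
From mathcomp Require Import zify ring lra.
From Stdlib Require Eqdep_dec.

(** A half-strand is [{y} * [0, 1]] inside a mapping cylinder.  If [a >= 0] is the
    weight of the point of [X_i] at its end [h = 1], let a point need the time
    [h / (1 + a - h)] to travel between the heights [0] and [h]: this time is [1 / a]
    for [h = 1], and infinite if [a = 0].  Cleared of denominators, the relation
    between elapsed time and the two heights is a polynomial equation which remains
    meaningful at [a = 0], [h = 1], where it forces rest.  So "[x'] is reached from [x]
    in time [t >= 0]" is a composition of boundedly many relations each of which is
    compact for bounded [t] and definable.  The heights are forced by the gluing, so
    this relation is deterministic forwards and, by the symmetry exchanging the
    [rho]- and the [lam]-cylinders, backwards.  It is thus one half of the graph of a
    flow, which is tame, and continuous because its graph over bounded times is
    compact.  The height function with [X_i] at level [i] is a Lyapunov function. *)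

Import (canonicals) mpoly.

Set Implicit Arguments.
Unset Strict Implicit.
Unset Printing Implicit Defensive.
Import Order.TTheory GRing.Theory Num.Theory.
Import numFieldNormedType.Exports.
Local Open Scope classical_set_scope.
Local Open Scope ring_scope.

(** * Flows on glued half-strands *)

(** The weight of an end must come back as the inverse of the time spent between that end and the
    middle level. This fixes the travel time at [h = 0] and [h = 1] only; a fractional linear
    function of [h] is the simplest choice in between, and it is inverted explicitly within the
    definable world. The obstacle is the neighbourhood of the stationary points: whole families of
    strands end in one such point, travel times tend to infinity, and strand coordinates are no
    longer functions of the point. Continuity of a formula for the flow would need estimates uniform
    over all those strands. For a relation that is compact over bounded times, uniqueness of the
    value already gives continuity. The bound on the number of steps matters twice, since neither
    compactness nor definability survives an infinite union. It comes from the index of the strand,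
    which drops each time a trajectory passes through some [X_i] on its way down. *)

Section Clock.
Variable R : realFieldType.
Implicit Types a t h : R.

(** The equation [t = ctime a h - ctime a h'] with denominators cleared: positive [t] lowers the
    height from [h] to [h']. For [a = 0], with either height equal to [1], it reads [0 = h - h']. *)
Definition clock a t h h' : Prop :=
  t * (1 + a - h) * (1 + a - h') = (1 + a) * (h - h').

Definition ctime a h : R := h / (1 + a - h).

Lemma clock_fin a h : 0 <= a -> 0 <= h <= 1 -> ~ (h = 1 /\ a = 0) -> 0 < 1 + a - h.
Proof.
move=> a0 /andP[h0 h1] n; rewrite lt_neqAle; apply/andP; split; last lra.
by apply/eqP => e; apply: n; split; lra.
Qed.

Lemma clockP a t h h' : 0 < 1 + a - h -> 0 < 1 + a - h' ->
  clock a t h h' <-> t = ctime a h - ctime a h'.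
Proof.
move=> p p'; rewrite /clock /ctime; split=> [e|->].
  by apply: (mulIf (lt0r_neq0 p)); apply: (mulIf (lt0r_neq0 p')); rewrite e; field;
    rewrite ?lt0r_neq0.
by field; rewrite ?lt0r_neq0.
Qed.

Lemma ctime_le a h h' : 0 <= a -> h' < 1 + a -> 0 <= h -> h <= h' -> ctime a h <= ctime a h'.
Proof.
move=> a0 p h0 hh; rewrite /ctime ler_pdivrMr; last by lra.
rewrite mulrAC ler_pdivlMr; last by lra.
nra.
Qed.

(** The height stays at most [1] as long as the total time is at most [a^-1]. The case [a = 0] is
    separate because [0^-1] is [0] here, while the end is then never reached. *)
Lemma ctime_solve a h t : 0 <= a -> 0 <= h <= 1 -> 0 < 1 + a - h ->
   0 <= t -> (a = 0 \/ ctime a h + t <= a^-1) ->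
  exists h', [/\ 0 <= h' <= 1, 0 < 1 + a - h' & ctime a h' = ctime a h + t].
Proof.
move=> a0 /andP[h0 h1] p t0 tb.
set T := ctime a h + t.
have T0 : 0 <= T by rewrite addr_ge0// /ctime divr_ge0// ltW.
have key : 0 < 1 + T by lra.
(* The solution of [T = h' / (1 + a - h')] for [h']. *)
exists (T * (1 + a) / (1 + T)).
have e : 1 + a - T * (1 + a) / (1 + T) = (1 + a) / (1 + T).
  by field; rewrite lt0r_neq0.
split.
- apply/andP; split; first by rewrite divr_ge0 ?mulr_ge0//; lra.
  rewrite ler_pdivrMr// mul1r.
  case: tb => [->|]; first lra.
  rewrite -/T => Ta.
  case: (eqVneq a 0) => [->|an]; first lra.
  have ap : 0 < a by rewrite lt_neqAle eq_sym an.
  have : T * a <= 1 by rewrite -ler_pdivlMr// mul1r.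
  lra.
- by rewrite e divr_gt0//; lra.
- rewrite /ctime e; field; rewrite !lt0r_neq0//; lra.
Qed.

Lemma ctime_inj a h h' : 0 <= a -> 0 < 1 + a - h -> 0 < 1 + a - h' ->
  ctime a h = ctime a h' -> h = h'.
Proof.
move=> a0 p p' /eqP; rewrite /ctime eqr_div ?lt0r_neq0// => /eqP e.
have : (1 + a) * (h - h') = 0 by lra.
by move/eqP; rewrite mulf_eq0 => /orP[] /eqP; lra.
Qed.

Lemma ctime_leE a h h' : 0 <= a -> h <= 1 -> 0 <= h' -> 0 < 1 + a - h -> 0 < 1 + a - h' ->
  ctime a h <= ctime a h' -> h <= h'.
Proof.
move=> a0 h1 h0 p p' le; rewrite leNgt; apply/negP => l.
have l2 : ctime a h' <= ctime a h by apply: ctime_le; lra.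
have /(ctime_inj a0 p p') : ctime a h = ctime a h' by lra.
lra.
Qed.

Lemma clock_lt a t h h' : 0 <= a -> 0 < 1 + a - h -> 0 < 1 + a - h' ->
  clock a t h h' -> 0 < t -> h' < h.
Proof.
move=> a0 p p' c t0.
have : 0 < (1 + a) * (h - h') by rewrite -c !mulr_gt0.
by rewrite pmulr_rgt0; lra.
Qed.

End Clock.

(** * Half-strands glued at their ends, and motion along them in elementary steps *)

Section Strands.
Variables (R : realFieldType) (E : choiceType) (Y : Type) (X crit : set E).
Variables (S : set Y) (n : nat).

(** The strand [y] has its middle at height [0] of both halves; the [true] half lies above it, the
    [false] half below, each ending at height [1]. Injectivity and the overlap of halves are
    demanded only off [crit], since many strands may end in one critical point. [lev] bounds how
    often a trajectory can change strands. *)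
Record strand_system (G : bool -> Y -> R -> E) (a : bool -> Y -> R) (lev : Y -> nat) : Prop := {
  crit_sub : crit `<=` X;
  strand_sub b y h : S y -> 0 <= h <= 1 -> X (G b y h);
  strand_cover x : X x -> crit x \/ exists b y h, [/\ S y, 0 <= h <= 1 & x = G b y h];
  strand_mid y : S y -> G true y 0 = G false y 0;
  weight_ge0 b y : S y -> 0 <= a b y;
  crit_strand b y h : S y -> 0 <= h <= 1 -> crit (G b y h) <-> (h = 1 /\ a b y = 0);
  strand_inj b y h y' h' : S y -> S y' -> 0 <= h <= 1 -> 0 <= h' <= 1 ->
    ~ crit (G b y h) -> G b y h = G b y' h' -> y = y' /\ h = h';
  strand_cross y h y' h' : S y -> S y' -> 0 <= h <= 1 -> 0 <= h' <= 1 ->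
    ~ crit (G true y h) -> G true y h = G false y' h' -> (h = 0 /\ h' = 0) \/ (h = 1 /\ h' = 1);
  strand_end b y : S y -> ~ crit (G b y 1) -> exists2 y', S y' & G (~~ b) y' 1 = G b y 1;
  lev_lt y y' : S y -> S y' -> ~ crit (G true y 1) -> G true y 1 = G false y' 1 ->
    (lev y < lev y')%N;
  lev_le y : S y -> (lev y <= n)%N
}.

(** Exchanging the halves reverses time, so each forward statement about a system yields a backward
    one. The bound [lev_le] makes [n - lev] reverse the order strictly. *)
Lemma strand_mirror G a lev : strand_system G a lev ->
  strand_system (fun b => G (~~ b)) (fun b => a (~~ b)) (fun y => n - lev y)%N.
Proof.
case=> H1 H2 H3 H4 H5 H6 H7 H8 H9 H10 H11; split => //=.
- by move=> b; apply: H2.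
- move=> x /H3 [|[b [y [h [*]]]]]; [by left|right].
  by exists (~~ b), y, h; rewrite negbK.
- by move=> y /H4.
- by move=> b; apply: H5.
- by move=> b; apply: H6.
- by move=> b; apply: H7.
- move=> y h y' h' Sy Sy' hb hb' nc e.
  rewrite e in nc.
  by case: (H8 _ _ _ _ Sy' Sy hb' hb nc (esym e)) => -[-> ->]; [left|right].
- by move=> b y Sy; exact: H9.
- move=> y y' Sy Sy' nc e; rewrite e in nc.
  have := H10 _ _ Sy' Sy nc (esym e); have := H11 _ Sy => l1 l2.
  by rewrite ltn_sub2l// (leq_trans l2).
- by move=> y Sy; rewrite leq_subr.
Qed.

Section Step.
Variables (G : bool -> Y -> R -> E) (a : bool -> Y -> R).

Definition slide b t x x' : Prop := exists y h h',
  [/\ S y, 0 <= h <= 1, 0 <= h' <= 1 & [/\ x = G b y h, x' = G b y h' & clock (a b y) t h h']].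

(* Along the [true] half of a strand the height decreases with time, along the
   [false] half it increases. *)
Definition step t x x' : Prop :=
  [/\ 0 <= t, X x, X x' & [\/ t = 0 /\ x = x', crit x /\ x = x',
    slide true t x x' | slide false t x' x]].

Fixpoint steps m t x z : Prop := if m is m'.+1 then
    exists s r y, [/\ step s x y, steps m' r y z & t = s + r]
  else [/\ t = 0, X x & x = z].

Definition reach t x z := exists m, steps m t x z.

Lemma steps_ge0 m t x z : steps m t x z -> 0 <= t.
Proof.
elim: m t x => [|m IH] t x /=; first by case=> ->.
by case=> s [r [y [[s0 _ _ _] /IH r0 ->]]]; rewrite addr_ge0.
Qed.

Lemma steps_X m t x z : steps m t x z -> X x /\ X z.
Proof.
elim: m t x => [|m IH] t x /=; first by case=> _ ? <-.
by case=> s [r [y [[_ ? _ _] /IH [] _ ? _]]].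
Qed.

Lemma step_refl x : X x -> step 0 x x.
Proof. by move=> Xx; split=> //; apply: Or41. Qed.

Lemma step_steps t x z : step t x z -> steps 1 t x z.
Proof. by move=> st; exists t, 0, z; rewrite addr0; split=> //; split=> //; case: st. Qed.

Lemma steps_trans m k s t x y z :
  steps m s x y -> steps k t y z -> steps (m + k) (s + t) x z.
Proof.
elim: m s x => [|m IH] s x /=; first by case=> -> _ ->; rewrite add0r.
case=> s1 [r [x1 [st1 str ->]]] stk; exists s1, (r + t), x1; split=> //.
  exact: IH str stk.
by rewrite addrA.
Qed.

(** Rests of duration [0] pad a path, so the index of [steps] acts as an upper bound. *)
Lemma steps_leq m k t x z : (m <= k)%N -> steps m t x z -> steps k t x z.
Proof.
move=> /subnK <-; elim: (k - m)%N => [//|j IH] st.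
rewrite addSn; exists 0, t, x; rewrite add0r; split=> //; last exact: IH.
by apply: step_refl; case: (steps_X st).
Qed.

Lemma reach_trans s t x y z : reach s x y -> reach t y z -> reach (s + t) x z.
Proof. by move=> [m h] [k h']; exists (m + k)%N; apply: steps_trans h h'. Qed.

Lemma step_reach t x z : step t x z -> reach t x z.
Proof. by exists 1%N; apply: step_steps. Qed.

End Step.

(** * Determinism and totality of the forward motion *)

Section Determinism.
Variables (G : bool -> Y -> R -> E) (a : bool -> Y -> R) (lev : Y -> nat).
Hypothesis H : strand_system G a lev.
Notation step := (step G a).
Notation steps := (steps G a).
Notation reach := (reach G a).
Notation slide := (slide G a).

Lemma strand_fin b y h : S y -> 0 <= h <= 1 -> ~ crit (G b y h) -> 0 < 1 + a b y - h.
Proof.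
move=> Sy hb nc; apply: clock_fin => //; first exact: (weight_ge0 H).
by move=> e; apply: nc; apply/(crit_strand H b Sy hb).
Qed.

Lemma slide_X b t x x' : slide b t x x' -> X x /\ X x'.
Proof.
by case=> y [h [h' [Sy hb hb' [-> -> _]]]]; split; exact: (strand_sub H).
Qed.

(** A critical point of a strand has [a = 0] and height [1], where [clock] degenerates to
    [h = h']. *)
Lemma slide_crit b t x x' : slide b t x x' -> (crit x -> x = x') /\ (crit x' -> x = x').
Proof.
case=> y [h [h' [Sy hb hb' [-> -> c]]]].
have [p1 p2] := (andP hb, andP hb').
by split=> /(crit_strand H _ Sy) []//; rewrite /clock in c => e a0; congr (G _ _ _); nra.
Qed.

Lemma step_crit t x x' : step t x x' -> (crit x -> x = x') /\ (crit x' -> x = x').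
Proof.
case=> _ _ _ [[_ ->]//|[_ ->]//|/slide_crit//|/slide_crit[h h']].
by split=> c; [rewrite h'|rewrite h].
Qed.

Lemma slide_fwd b t x x' : slide b t x x' -> ~ crit x -> 0 <= t -> exists y h h',
  [/\ S y, 0 <= h <= 1, 0 <= h' <= 1 & [/\ x = G b y h, x' = G b y h', 
   0 < 1 + a b y - h, 0 < 1 + a b y - h' & t = ctime (a b y) h - ctime (a b y) h']].
Proof.
move=> mv nc t0.
have nc' : ~ crit x' by move=> c; apply: nc; case: (slide_crit mv) => _ ->.
case: mv nc nc' => y [h [h' [Sy hb hb' [-> -> c]]]] nc nc'.
have [p p'] := (strand_fin Sy hb nc, strand_fin Sy hb' nc').
by exists y, h, h'; split=> //; split=> //; apply/clockP.
Qed.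

Lemma slide0 b x x' : slide b 0 x x' -> x = x'.
Proof.
move=> mv.
case: (pselect (crit x)) => [/(proj1 (slide_crit mv))//|nc].
have [y [h [h' [Sy _ _ [-> -> p p' e]]]]] := slide_fwd mv nc (lexx _).
congr (G _ _ _); apply: (ctime_inj _ p p'); first exact: (weight_ge0 H).
by lra.
Qed.

Lemma step0 x x' : step 0 x x' -> x = x'.
Proof. by case=> _ _ _ [[_ ->]|[_ ->]|/slide0|/slide0->]. Qed.

Lemma slide_det b s t x y z : slide b s x y -> slide b t x z -> ~ crit x -> s <= t -> 0 <= s ->
  slide b (t - s) y z.
Proof.
move=> ms mt nc st s0.
have [u [h [h' [Su hb hb' [ex -> p p' e]]]]] := slide_fwd ms nc s0.
have [u2 [h2 [h2' [Su2 hb2 hb2' [ex2 -> p2 p2' e2]]]]] := slide_fwd mt nc (le_trans s0 st).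
have [? ?] : u = u2 /\ h = h2 by apply: (strand_inj H (b := b)) => //; rewrite -ex.
subst u2 h2; exists u, h', h2'; split=> //; split=> //.
by apply/clockP=> //; lra.
Qed.

Lemma slide_codet b s t x y z : slide b s y x -> slide b t z x -> ~ crit x -> s <= t -> 0 <= s ->
  slide b (t - s) z y.
Proof.
move=> ms mt nc st s0.
have ncy : ~ crit y by move=> c; apply: nc; case: (slide_crit ms) => <-.
have ncz : ~ crit z by move=> c; apply: nc; case: (slide_crit mt) => <-.
have [u [h [h' [Su hb hb' [-> ex p p' e]]]]] := slide_fwd ms ncy s0.
have [u2 [h2 [h2' [Su2 hb2 hb2' [-> ex2 p2 p2' e2]]]]] := slide_fwd mt ncz (le_trans s0 st).
have [? ?] : u = u2 /\ h' = h2' by apply: (strand_inj H (b := b)) => //; rewrite -ex.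
subst u2 h2'; exists u, h2, h; split=> //; split=> //.
by apply/clockP=> //; lra.
Qed.

(** The point [x] would lie on two halves, hence at height [0] of both or at height [1] of both. At
    the middle the height on the [true] half cannot fall further, at the end the height on the
    [false] half cannot rise further. *)
Lemma slide_excl s t x y z : 0 < s -> 0 < t -> ~ crit x ->
  slide true s x y -> slide false t z x -> False.
Proof.
move=> s0 t0 nc ms mt.
have ncz : ~ crit z by move=> c; apply: nc; case: (slide_crit mt) => <-.
have [u [h [h' [Su hb hb' [ex _ p p' e]]]]] := slide_fwd ms nc (ltW s0).
have [v [k [k' [Sv kb kb' [_ ex2 q q' e2]]]]] := slide_fwd mt ncz (ltW t0).
have l1 : h' < h by apply: (clock_lt (weight_ge0 H true Su) p p' _ s0); apply/clockP.
have l2 : k' < k by apply: (clock_lt (weight_ge0 H false Sv) q q' _ t0); apply/clockP.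
have [] : (h = 0 /\ k' = 0) \/ (h = 1 /\ k' = 1).
- by apply: (strand_cross H Su Sv) => //; rewrite -ex.
- case=> e3 _; move/andP: hb' => [? ?]; lra.
- case=> _ e4; move/andP: kb => [? ?]; lra.
Qed.

(** Off [crit], two steps of positive time from one point use the same kind of half by [slide_excl];
    then [slide_det] or [slide_codet] subtracts the times. *)
Lemma step_det s t x y z : step s x y -> step t x z -> s <= t -> step (t - s) y z.
Proof.
move=> ss tt st.
have [s0 Xx Xy _] := ss; have [t0 _ Xz _] := tt.
have [cx|ncx] := pselect (crit x).
  rewrite -(proj1 (step_crit ss) cx) -(proj1 (step_crit tt) cx); split=> //; first lra.
  by apply: Or42.
case: (eqVneq s 0) => [e|sn].
  by rewrite e subr0; move: ss; rewrite e => /step0 <-.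
case: (eqVneq t 0) => [e|tn].
  by have : s = 0 by [lra]; move/eqP; rewrite (negbTE sn).
have sp : 0 < s by rewrite lt_neqAle eq_sym sn.
have tp : 0 < t by rewrite lt_neqAle eq_sym tn.
have ts : 0 <= t - s by lra.
case: ss => _ _ _ [[/eqP]|[]|ms|ms]//; first by rewrite (negbTE sn).
  case: tt => _ _ _ [[/eqP]|[]|mt|mt]//; first by rewrite (negbTE tn).
    by split=> //; apply: Or43; apply: slide_det ms mt ncx st s0.
  by case: (slide_excl sp tp ncx ms mt).
case: tt => _ _ _ [[/eqP]|[]|mt|mt]//; first by rewrite (negbTE tn).
  by case: (slide_excl tp sp ncx mt ms).
by split=> //; apply: Or44; apply: slide_codet ms mt ncx st s0.
Qed.

(** The path is cut at time [s]. Either the cut falls within its first step, which [step_det]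
    splits, or that step ends earlier and the remaining time [s - s1] is cut off the rest of the
    path by induction. *)
Lemma step_steps_det k s t x y z : step s x y -> steps k t x z -> s <= t -> reach (t - s) y z.
Proof.
elim: k s t x => [|k IH] s t x ss.
  case=> -> Xx <- s0; have e : s = 0 by case: ss => ? _ _ _; lra.
  move: ss; rewrite e subr0 => /step0 <-.
  by exists 0%N.
case=> s1 [r [x1 [ss1 sr ->]]] st.
have [l|/ltW l] := leP s s1.
  rewrite (_ : s1 + r - s = (s1 - s) + r); last by lra.
  apply: (reach_trans (y := x1)); last by exists k.
  by apply/step_reach/(step_det ss ss1).
rewrite (_ : s1 + r - s = r - (s - s1)); last by lra.
by apply: (IH _ _ x1) => //; [exact: step_det ss1 ss l|lra].
Qed.

Lemma reach_det s t x y z : reach s x y -> reach t x z -> s <= t -> reach (t - s) y z.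
Proof.
case=> m; elim: m s t x => [|m IH] s t x.
  by case=> -> _ ->; rewrite subr0.
case=> s1 [r [x1 [ss1 sr ->]]] [k st] l.
have r0 := steps_ge0 sr.
have := step_steps_det ss1 st _ => /(_ ltac:(lra)) rt.
by have := IH _ _ _ sr rt; rewrite -addrA -opprD; apply; lra.
Qed.

Lemma reach0 x y : reach 0 x y -> x = y.
Proof.
case=> m; elim: m x => [|m IH] x; first by case.
case=> s [r [x1 [ss sr e]]].
have [s0 _ _ _] := ss; have r0 := steps_ge0 sr.
have [es er] : s = 0 /\ r = 0 by split; lra.
by subst s r; rewrite (step0 ss); apply: IH.
Qed.

Lemma reach_uniq t x y z : reach t x y -> reach t x z -> y = z.
Proof. by move=> h1 h2; have := reach_det h1 h2 (lexx _); rewrite subrr => /reach0. Qed.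

(** Here and in [step_down] the name tells the half, above or below the middle. Time runs from the
    upper half to the lower one, so the height falls here and rises there. *)
Lemma step_up y h h' : S y -> 0 <= h' -> h' <= h -> h <= 1 -> ~ crit (G true y h) ->
  step (ctime (a true y) h - ctime (a true y) h') (G true y h) (G true y h').
Proof.
move=> Sy h0 hh h1 nc.
have hb : 0 <= h <= 1 by apply/andP; split; lra.
have hb' : 0 <= h' <= 1 by apply/andP; split; lra.
have a0 := weight_ge0 H true Sy.
have p := strand_fin Sy hb nc.
split; [|exact: (strand_sub H)|exact: (strand_sub H)|].
  by rewrite subr_ge0 ctime_le//; lra.
apply: Or43; exists y, h, h'; split=> //; split=> //.
by apply/clockP => //; lra.
Qed.

Lemma step_down y h h' : S y -> 0 <= h -> h <= h' -> h' <= 1 -> ~ crit (G false y h') ->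
  step (ctime (a false y) h' - ctime (a false y) h) (G false y h) (G false y h').
Proof.
move=> Sy h0 hh h1 nc.
have hb : 0 <= h <= 1 by apply/andP; split; lra.
have hb' : 0 <= h' <= 1 by apply/andP; split; lra.
have a0 := weight_ge0 H false Sy.
have p := strand_fin Sy hb' nc.
split; [|exact: (strand_sub H)|exact: (strand_sub H)|].
  by rewrite subr_ge0 ctime_le//; lra.
apply: Or44; exists y, h', h; split=> //; split=> //.
by apply/clockP => //; lra.
Qed.

Lemma ctime0 b : ctime b 0 = 0 :> R.
Proof. by rewrite /ctime mul0r. Qed.

Lemma ctime1 b : ctime b 1 = b^-1 :> R.
Proof. by rewrite /ctime mul1r; congr (_^-1); ring. Qed.

(** A trajectory that outlasts the lower half has positive weight at its end, which is therefore not
    critical. Then [strand_end] provides an upper half to continue on, and [lev_lt] makes [lev]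
    drop. *)
Lemma exit_down y h t : S y -> 0 <= h <= 1 -> ~ crit (G false y h) -> 0 <= t ->
  (exists z, step t (G false y h) z) \/
  exists y' r, [/\ S y', (lev y' < lev y)%N, ~ crit (G true y' 1), r <= t &
    step r (G false y h) (G true y' 1)].
Proof.
move=> Sy hb nc t0.
have p := strand_fin Sy hb nc.
have a0 := weight_ge0 H false Sy.
have [h0 h1] := andP hb.
have [tb|tb] := pselect (a false y = 0 \/ ctime (a false y) h + t <= (a false y)^-1).
  left; have [h' [hb' p' e]] := ctime_solve a0 hb p t0 tb.
  have [? ?] := andP hb'.
  have hh : h <= h' by apply: (@ctime_leE _ (a false y)) => //; lra.
  exists (G false y h').
  rewrite (_ : t = ctime (a false y) h' - ctime (a false y) h); last lra.
  apply: step_down => //.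
  by move/(crit_strand H false Sy hb') => [? ?]; lra.
have an : a false y != 0 by apply/eqP => e; apply: tb; left.
have n1 : ~ crit (G false y 1).
  by move/(crit_strand H false Sy) => []; [lra|move=> _ /eqP; rewrite (negbTE an)].
have [y' Sy' /= e'] := strand_end H Sy n1.
have n1' : ~ crit (G true y' 1) by rewrite e'.
right; exists y', (ctime (a false y) 1 - ctime (a false y) h); split=> //.
- exact: (lev_lt H).
- by rewrite leNgt; apply/negP => l; apply: tb; right; rewrite -ctime1; lra.
- by rewrite e'; apply: step_down.
Qed.

Lemma exit_up y h t : S y -> 0 <= h <= 1 -> ~ crit (G true y h) -> 0 <= t ->
  (exists z, step t (G true y h) z) \/
  exists2 r, r <= t & step r (G true y h) (G false y 0).
Proof.
move=> Sy hb nc t0.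
have p := strand_fin Sy hb nc.
have a0 := weight_ge0 H true Sy.
have [h0 h1] := andP hb.
have [l|/ltW l] := leP t (ctime (a true y) h); last first.
  right; exists (ctime (a true y) h - ctime (a true y) 0); first by rewrite ctime0 subr0.
  by rewrite -(strand_mid H)//; exact: step_up.
left; have T0 : 0 <= ctime (a true y) h - t by lra.
(* The height left after time [t] is the one reached from the middle in time
   [ctime (a true y) h - t]; that it is at most [1] follows from monotonicity of [ctime] up to
   height [1]. *)
have [|||h' [hb' p' e]] := @ctime_solve _ (a true y) 0 _ a0 _ _ T0 _; try lra.
  have [->|an] := eqVneq (a true y) 0; [by left|right].
  rewrite ctime0 -ctime1 add0r.
  have ap : 0 < a true y by rewrite lt_neqAle eq_sym an.
  have : ctime (a true y) h <= ctime (a true y) 1 by apply: ctime_le => //; lra.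
  lra.
rewrite ctime0 add0r in e.
have [? ?] := andP hb'.
have hh : h' <= h by apply: (@ctime_leE _ (a true y)) => //; lra.
exists (G true y h').
rewrite (_ : t = ctime (a true y) h - ctime (a true y) h'); last lra.
exact: step_up.
Qed.

Lemma not_crit_lt1 b y h : S y -> 0 <= h < 1 -> ~ crit (G b y h).
Proof.
by move=> Sy /andP[h0 h1] /(crit_strand H b Sy) []; [apply/andP; split; lra | lra].
Qed.

Lemma steps_cons m r t x y z : step r x y -> steps m (t - r) y z -> steps m.+1 t x z.
Proof. by move=> st sm; exists r, (t - r), y; split=> //; ring. Qed.

(** Two steps per strand, one on each half, and at most [k + 1] strands because [lev] drops at each
    change of strand. *)
Lemma total_up k y h t : S y -> 0 <= h <= 1 -> ~ crit (G true y h) -> (lev y <= k)%N ->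
  0 <= t -> exists z, steps (2 * k + 2) t (G true y h) z.
Proof.
elim: k y h t => [|k IH] y h t Sy hb nc lk t0.
  have [[z /step_steps sz]|[r rt sr]] := exit_up Sy hb nc t0.
    by exists z; apply: steps_leq sz.
  have nc0 : ~ crit (G false y 0) by apply: not_crit_lt1 => //; lra.
  have tr : 0 <= t - r by lra.
  have hb0 : 0 <= (0 : R) <= 1 by lra.
  have [[z /step_steps sz]|[y' [r' [_ l]]]] := exit_down Sy hb0 nc0 tr.
    by exists z; apply: steps_cons sr _.
  by rewrite ltnNge (leq_trans lk) in l.
have [[z /step_steps sz]|[r rt sr]] := exit_up Sy hb nc t0.
  by exists z; apply: steps_leq sz.
have nc0 : ~ crit (G false y 0) by apply: not_crit_lt1 => //; lra.
have tr : 0 <= t - r by lra.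
have hb0 : 0 <= (0 : R) <= 1 by lra.
have [[z /step_steps sz]|[y' [r' [Sy' lv nc1 rt' sr']]]] := exit_down Sy hb0 nc0 tr.
  exists z; apply: (@steps_leq _ _ 2); first by lia.
  exact: steps_cons sr sz.
have tr' : 0 <= t - r - r' by lra.
have hb1 : 0 <= (1 : R) <= 1 by lra.
have lk' : (lev y' <= k)%N by rewrite -ltnS (leq_trans lv).
have [z sz] := IH _ _ _ Sy' hb1 nc1 lk' tr'.
exists z; rewrite mulnS add2n addSn; apply: steps_cons sr _.
exact: steps_cons sr' sz.
Qed.

(** One step more than in [total_up] with [k = n], for a start on a lower half. *)
Lemma steps_total t x : X x -> 0 <= t -> exists z, steps (2 * n + 3) t x z.
Proof.
move=> Xx t0.
have [c|nc] := pselect (crit x).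
  exists x; apply: (@steps_leq _ _ 1); first by rewrite addnC.
  by apply: step_steps; split=> //; apply: Or42.
have [//|[[] [y [h [Sy hb e]]]]] := strand_cover H Xx; rewrite e in nc *.
  have [z sz] := total_up Sy hb nc (lev_le H Sy) t0.
  by exists z; apply: steps_leq sz; lia.
have [[z /step_steps sz]|[y' [r' [Sy' lv nc1 rt' sr']]]] := exit_down Sy hb nc t0.
  by exists z; apply: steps_leq sz; lia.
have tr' : 0 <= t - r' by lra.
have hb1 : 0 <= (1 : R) <= 1 by lra.
have [z sz] := total_up Sy' hb1 nc1 (lev_le H Sy') tr'.
by exists z; rewrite addnS; apply: steps_cons sr' _.
Qed.

End Determinism.

(** * Time reversal *)

Section Mirror.
Variables (G : bool -> Y -> R -> E) (a : bool -> Y -> R).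
Notation G' := (fun b => G (~~ b)).
Notation a' := (fun b => a (~~ b)).

Lemma step_mirror t x z : step G' a' t x z <-> step G a t z x.
Proof.
split=> -[t0 Xx Xz h]; split=> //; case: h => [[? ->]|[? ?]|?|?];
  [by apply: Or41|by subst z; apply: Or42|exact: Or44|exact: Or43|
   by apply: Or41|by subst z; apply: Or42|exact: Or44|exact: Or43].
Qed.

Lemma steps_mirror m t x z : steps G' a' m t x z -> reach G a t z x.
Proof.
elim: m t x => [|m IH] t x /=; first by case=> -> Xx <-; exists 0%N.
case=> s [r [y [/step_mirror/step_reach ss /IH sr ->]]].
by rewrite addrC; apply: reach_trans sr ss.
Qed.

End Mirror.

Lemma reach_mirror (G : bool -> Y -> R -> E) (a : bool -> Y -> R) t x z :
  reach (fun b => G (~~ b)) (fun b => a (~~ b)) t x z <-> reach G a t z x.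
Proof.
split=> [[m /steps_mirror]//|].
have e (A : Type) (F : bool -> A) : F = (fun b => F (~~ ~~ b)).
  by apply/funext => b; rewrite negbK.
rewrite [in X in X -> _](e _ G) [in X in X -> _](e _ a).
by move=> [m /(@steps_mirror (fun b => G (~~ b)) (fun b => a (~~ b)))].
Qed.

(** * The flow as a one-parameter group *)

Section Flow.
Variables (G : bool -> Y -> R -> E) (a : bool -> Y -> R) (lev : Y -> nat).
Hypothesis H : strand_system G a lev.
Notation step := (step G a).
Notation steps := (steps G a).
Notation reach := (reach G a).

Definition flow_rel t x z := (0 <= t /\ reach t x z) \/ (t <= 0 /\ reach (- t) z x).

Definition flow t x := xget x [set z | flow_rel t x z].

Lemma reach_codet s t x y z : reach s y x -> reach t z x -> s <= t -> reach (t - s) z y.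
Proof.
rewrite -!(reach_mirror G a) => h1 h2 st.
exact: (reach_det (strand_mirror H) h1 h2 st).
Qed.

Lemma reach_ge0 t x y : reach t x y -> 0 <= t.
Proof. by case=> m /steps_ge0. Qed.

Lemma reach_X t x y : reach t x y -> X x /\ X y.
Proof. by case=> m /steps_X. Qed.

Lemma reach_refl x : X x -> reach 0 x x.
Proof. by exists 0%N. Qed.

(** For opposite signs the two motions share their start or their arrival, so one is an initial or a
    final piece of the other. This is where determinism in both directions enters. *)
Lemma flow_relD s t x y z : flow_rel t x y -> flow_rel s y z -> flow_rel (s + t) x z.
Proof.
move=> [] [t0 h1] [] [s0 h2].
- left; split; [exact: addr_ge0|by rewrite addrC; exact: reach_trans h1 h2].
- have [l|/ltW l] := leP 0 (s + t).
    left; split=> //; rewrite (_ : s + t = t - - s); last by ring.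
    by apply: reach_codet h2 h1 _; lra.
  right; split=> //; rewrite (_ : - (s + t) = - s - t); last by ring.
  by apply: reach_codet h1 h2 _; lra.
- have [l|/ltW l] := leP 0 (s + t).
    left; split=> //; rewrite (_ : s + t = s - - t); last by ring.
    by apply: (reach_det H) h1 h2 _; lra.
  right; split=> //; rewrite (_ : - (s + t) = - t - s); last by ring.
  by apply: (reach_det H) h2 h1 _; lra.
- right; split; first by lra.
  by rewrite opprD; apply: reach_trans h2 h1.
Qed.

Lemma flow_rel_uniq t x y z : flow_rel t x y -> flow_rel t x z -> y = z.
Proof.
move=> h1 h2.
have h3 : flow_rel (- t) y x.
  case: h1 => -[t0 h]; [right|left]; split; rewrite ?opprK //; lra.
have := flow_relD h3 h2; rewrite subrr => -[] [_]; last rewrite oppr0.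
  exact: (reach0 H).
by move/(reach0 H).
Qed.

Definition nsteps := (2 * n + 3)%N.

Lemma flow_rel_total t x : X x -> exists z, flow_rel t x z.
Proof.
move=> Xx; have [l|/ltW l] := leP 0 t.
  by have [z sz] := steps_total H Xx l; exists z; left; split=> //; exists (2 * n + 3)%N.
have [|z sz] := steps_total (strand_mirror H) Xx (t := - t); first lra.
by exists z; right; split=> //; apply/reach_mirror; exists (2 * n + 3)%N.
Qed.

(** [reach] quantifies over all path lengths, which is neither a compact nor a definable condition
    as it stands. Totality provides a path of [nsteps] steps and the same duration, and uniqueness
    makes it end at [z]. *)
Lemma reach_steps t x z : reach t x z -> steps nsteps t x z.
Proof.
move=> h; have [Xx Xz] := reach_X h.
have [z' sz] := steps_total H Xx (reach_ge0 h).
by have <- : z' = z by apply: (reach_uniq H _ h); exists (2 * n + 3)%N.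
Qed.

Lemma flowP t x z : X x -> flow t x = z <-> flow_rel t x z.
Proof.
move=> Xx; have [y hy] := flow_rel_total t Xx.
have hf : flow_rel t x (flow t x) by apply: (xgetPex x (P := [set z | flow_rel t x z])); exists y.
by split=> [<-//|]; apply: flow_rel_uniq.
Qed.

Lemma flow_rel_X t x z : flow_rel t x z -> X x /\ X z.
Proof. by case=> -[_ /reach_X[]]. Qed.

Lemma flow_X t x : X x -> X (flow t x).
Proof. by move=> Xx; have /(flowP t _ Xx)/flow_rel_X[] := erefl (flow t x). Qed.

Lemma flow0 x : X x -> flow 0 x = x.
Proof. by move=> Xx; apply/flowP => //; left; split=> //; apply: reach_refl. Qed.

Lemma flowD s t x : X x -> flow (s + t) x = flow s (flow t x).
Proof.
move=> Xx; apply/flowP => //; apply: (@flow_relD _ _ _ (flow t x)); first exact/flowP.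
by apply/flowP => //; apply: flow_X.
Qed.

Lemma flow_step t x z : step t x z -> flow t x = z.
Proof.
move=> st; have [t0 Xx _ _] := st; apply/flowP => //.
by left; split=> //; apply: step_reach.
Qed.

Lemma flow_stepN t x z : step t x z -> flow (- t) z = x.
Proof.
move=> st; have [t0 _ Xz _] := st; apply/flowP => //.
by right; rewrite opprK; split; [lra|apply: step_reach].
Qed.

Lemma flow_crit t x : crit x -> flow t x = x.
Proof.
move=> c; have Xx := crit_sub H c.
have st s : 0 <= s -> step s x x by move=> s0; split=> //; apply: Or42.
have [l|/ltW l] := leP 0 t; first exact/flow_step/st.
by rewrite -[t]opprK; apply/flow_stepN/st; lra.
Qed.

Lemma flow_ncrit t x : X x -> ~ crit x -> ~ crit (flow t x).
Proof.
move=> Xx nc c; apply: nc.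
have := flow_crit (- t) c.
by rewrite -flowD// addNr flow0// => ->.
Qed.

Lemma flow_decreasing (f : E -> R) :
  (forall b y h h', S y -> 0 <= h <= 1 -> 0 <= h' <= 1 -> h' < h ->
    if b then f (G b y h') < f (G b y h) else f (G b y h) < f (G b y h')) ->
  forall x s t, X x -> ~ crit x -> s < t -> f (flow t x) < f (flow s x).
Proof.
move=> mon x s t Xx nc st.
rewrite (_ : t = (t - s) + s); last by ring.
rewrite flowD//.
have := flow_ncrit (t := s) Xx nc; have := flow_X s Xx; move: (flow s x) => {}x {}Xx {}nc.
have {st} : 0 < t - s by lra.
move: (t - s) => {s}t t0.
(* Paths may contain rests of duration [0], so a single step lowers [f] strictly only if it takes
   positive time. *)
have one r u w : step r u w -> ~ crit u -> ~ crit w /\ (f w < f u \/ (r = 0 /\ w = u)).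
  move=> st ncu; have ncw : ~ crit w by move=> c; apply: ncu; rewrite (proj2 (step_crit H st) c).
  split=> //; case: (eqVneq r 0) => [e|rn].
    by right; split=> //; rewrite e in st; rewrite (step0 H st).
  left; case: st => r0 Xu Xw; have rp : 0 < r by rewrite lt_neqAle eq_sym rn.
  case=> [[/eqP]|[]|mv|mv]//; first by rewrite (negbTE rn).
    have [y [h [h' [Sy hb hb' [-> -> p p' e]]]]] := slide_fwd H mv ncu r0.
    have l := clock_lt (weight_ge0 H true Sy) p p' _ rp.
    by apply: (mon true) => //; apply: l; apply/clockP.
  have [y [h [h' [Sy hb hb' [-> -> p p' e]]]]] := slide_fwd H mv ncw r0.
  have l := clock_lt (weight_ge0 H false Sy) p p' _ rp.
  by apply: (mon false) => //; apply: l; apply/clockP.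
have many m r u w : steps m r u w -> ~ crit u -> f w <= f u /\ (0 < r -> f w < f u).
  elim: m r u => [|m IH] r u /=.
    by case=> -> _ -> _; split=> //; rewrite ltxx.
  case=> r1 [r2 [v [sv sw ->]]] ncu.
  have [ncv] := one _ _ _ sv ncu; have [l1 l2] := IH _ _ sw ncv.
  case=> [lt|[e1 e2]]; last by subst r1 v; rewrite add0r.
  by split=> [|_]; [exact: le_trans (ltW lt)|exact: le_lt_trans lt].
have /(flowP t _ Xx) [[_ [m sm]]|[]] := erefl (flow t x); last by lra.
by apply: (proj2 (many _ _ _ _ sm nc)).
Qed.

End Flow.
End Strands.

(** * Definability *)

(** An intersection of structures is a structure. The definability of the flow is established inside
    this one. *)
Lemma is_structure_tame (R : realType) : is_structure (@tame R).
Proof.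
split.
- by move=> n k ps S HS ? ?; apply: structure_algebraic.
- by move=> n a b S HS ? ?; apply: structure_halfspace.
- by move=> n A B hA hB S HS ? ?; apply: structure_setU; [|exact: hA|exact: hB].
- by move=> n A B hA hB S HS ? ?; apply: structure_setI; [|exact: hA|exact: hB].
- by move=> n A hA S HS ? ?; apply: structure_setC; [|exact: hA].
- by move=> n m A B hA hB S HS ? ?; apply: structure_prod; [|exact: hA|exact: hB].
- by move=> n m M b A hA S HS ? ?; apply: structure_affine; [|exact: hA].
Qed.

(** * Polynomial functions and maps on coordinate spaces *)

Section Polynomial.
Variable R : realType.

Definition polyfun n (g : 'rV[R]_n -> R) :=
  exists p : mpoly.mpoly n R, forall x, g x = mpoly.meval (fun i => x ord0 i) p.

Definition polymap n m (u : 'rV[R]_n -> 'rV[R]_m) :=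
  forall j, polyfun (fun x => u x ord0 j).

Lemma polyfun_cst n (c : R) : polyfun (fun _ : 'rV_n => c).
Proof. by exists (mpoly.mpolyC n c) => x; rewrite mpoly.mevalC. Qed.

Lemma polyfun_add n (f g : 'rV[R]_n -> R) :
  polyfun f -> polyfun g -> polyfun (fun x => f x + g x).
Proof. by move=> [p hp] [r hr]; exists (p + r) => x; rewrite mpoly.mevalD hp hr. Qed.

Lemma polyfun_opp n (f : 'rV[R]_n -> R) : polyfun f -> polyfun (fun x => - f x).
Proof. by move=> [p hp]; exists (- p) => x; rewrite mpoly.mevalN hp. Qed.

Lemma polyfun_mul n (f g : 'rV[R]_n -> R) :
  polyfun f -> polyfun g -> polyfun (fun x => f x * g x).
Proof. by move=> [p hp] [r hr]; exists (p * r) => x; rewrite mpoly.mevalM hp hr. Qed.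

Lemma polymap_id n : polymap (fun x : 'rV[R]_n => x).
Proof.
by move=> j; exists (mpoly.mpolyX R (mpoly.mnm1 j)) => x; rewrite mpoly.mevalXU.
Qed.

Lemma polymap_cst n m (v : 'rV[R]_m) : polymap (fun _ : 'rV_n => v).
Proof. by move=> j; apply: polyfun_cst. Qed.

Lemma polymap_lsubmx n m k (u : 'rV[R]_n -> 'rV_(m + k)) :
  polymap u -> polymap (fun x => lsubmx (u x)).
Proof.
move=> hu j; have [p hp] := hu (lshift k j).
by exists p => x; rewrite mxE hp.
Qed.

Lemma polymap_rsubmx n m k (u : 'rV[R]_n -> 'rV_(m + k)) :
  polymap u -> polymap (fun x => rsubmx (u x)).
Proof.
move=> hu j; have [p hp] := hu (rshift m j).
by exists p => x; rewrite mxE hp.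
Qed.

Lemma polymap_const_mx n m (g : 'rV[R]_n -> R) :
  polyfun g -> polymap (fun x => const_mx (g x) : 'rV_m).
Proof. by move=> [p hp] j; exists p => x; rewrite mxE hp. Qed.

Lemma polymap_row_mx n m k (u : 'rV[R]_n -> 'rV_m) (v : 'rV[R]_n -> 'rV_k) :
  polymap u -> polymap v -> polymap (fun x => row_mx (u x) (v x)).
Proof.
move=> hu hv j; case: (splitP j) => i e.
  have [p hp] := hu i; exists p => x; rewrite -hp (_ : j = lshift k i) ?row_mxEl//.
  exact: val_inj.
have [p hp] := hv i; exists p => x; rewrite -hp (_ : j = rshift m i) ?row_mxEr//.
exact: val_inj.
Qed.

Lemma polyfun_comp n m (g : 'rV[R]_m -> R) (u : 'rV[R]_n -> 'rV_m) :
  polyfun g -> polymap u -> polyfun (fun x => g (u x)).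
Proof.
move=> [p hp] /choice[r hr].
exists (mpoly.comp_mpoly [tuple r i | i < m] p) => x.
rewrite hp mpoly.comp_mpoly_meval; apply: mpoly.meval_eq => i.
by rewrite tnth_mktuple hr.
Qed.

Lemma polymap_comp n m k (v : 'rV[R]_m -> 'rV_k) (u : 'rV[R]_n -> 'rV_m) :
  polymap v -> polymap u -> polymap (fun x => v (u x)).
Proof. by move=> hv hu j; exact: (polyfun_comp (hv j) hu). Qed.

Lemma polyfun_coord n m (u : 'rV[R]_n -> 'rV_m) j : polymap u ->
  polyfun (fun x => u x ord0 j).
Proof. exact. Qed.

End Polynomial.

Ltac polyt := repeat match goal with
  | H : polyfun ?g |- polyfun ?g => exact: H
  | H : polymap ?g |- polymap ?g => exact: H
  | |- polyfun (fun _ => ?c) => exact: polyfun_cst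
  | |- polymap (fun _ => ?c) => exact: polymap_cst
  | |- polymap (fun x => x) => exact: polymap_id
  | |- polyfun (fun x => _ + _) => apply: polyfun_add
  | |- polyfun (fun x => - _) => apply: polyfun_opp
  | |- polyfun (fun x => _ * _) => apply: polyfun_mul
  | |- polyfun (fun x => fun_of_matrix _ _ _) => apply: polyfun_coord
  | |- polymap (@lsubmx _ _ _ _) => exact: (polymap_lsubmx (@polymap_id _ _))
  | |- polymap (@rsubmx _ _ _ _) => exact: (polymap_rsubmx (@polymap_id _ _))
  | |- polymap (fun x => lsubmx _) => apply: polymap_lsubmx
  | |- polymap (fun x => rsubmx _) => apply: polymap_rsubmx
  | |- polymap (fun x => row_mx _ _) => apply: polymap_row_mx
  | |- polymap (fun x => const_mx _) => apply: polymap_const_mx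
  | H : polyfun _ |- polyfun _ => apply: (polyfun_comp H)
  | H : polymap _ |- polymap _ => apply: (polymap_comp H)
  end.

(** * First-order formulas over a structure *)

Section Definable.
Variables (R : realType) (S : sets_of_Rn R).
Hypothesis HS : is_structure S.

Definition dfn n (P : 'rV[R]_n -> Prop) : Prop := S [set x | P x].

Lemma dfn_iff n (P Q : 'rV[R]_n -> Prop) : (forall x, P x <-> Q x) -> dfn P -> dfn Q.
Proof. by move=> h; rewrite (_ : P = Q)//; apply/funext => x; apply/propext. Qed.

Lemma dfn_and n (P Q : 'rV[R]_n -> Prop) : dfn P -> dfn Q -> dfn (fun x => P x /\ Q x).
Proof. by move=> hP hQ; exact: (structure_setI HS hP hQ). Qed.

Lemma dfn_and3 n (P Q T : 'rV[R]_n -> Prop) : dfn P -> dfn Q -> dfn T ->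
  dfn (fun x => [/\ P x, Q x & T x]).
Proof.
move=> hP hQ hT; apply: dfn_iff (dfn_and hP (dfn_and hQ hT)) => x.
by split=> [[? []]|[]].
Qed.

Lemma dfn_or n (P Q : 'rV[R]_n -> Prop) : dfn P -> dfn Q -> dfn (fun x => P x \/ Q x).
Proof. by move=> hP hQ; exact: (structure_setU HS hP hQ). Qed.

Lemma dfn_algebraic n k (g : 'I_k -> 'rV[R]_n -> R) : (forall j, polyfun (g j)) ->
  dfn (fun x => forall j, g j x = 0).
Proof.
move=> /choice[p hp]; apply: dfn_iff (structure_algebraic HS p) => x /=.
by split=> h j; [rewrite hp|rewrite -hp]; apply: h.
Qed.

Lemma dfn_eq0 n (g : 'rV[R]_n -> R) : polyfun g -> dfn (fun x => g x = 0).
Proof.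
move=> hg; apply: dfn_iff (dfn_algebraic (g := fun _ : 'I_1 => g) (fun=> hg)) => x.
by split=> [/(_ ord0)|].
Qed.

Lemma dfn_eq n (g h : 'rV[R]_n -> R) : polyfun g -> polyfun h -> dfn (fun x => g x = h x).
Proof.
move=> hg hh; apply: (@dfn_iff _ (fun x => g x - h x = 0)) => [x|].
  by split=> [/subr0_eq|->]; rewrite ?subrr.
by apply: dfn_eq0; polyt.
Qed.

Lemma dfn_eqv n m (u v : 'rV[R]_n -> 'rV_m) : polymap u -> polymap v ->
  dfn (fun x => u x = v x).
Proof.
move=> hu hv; apply: (@dfn_iff _ (fun x => forall j, u x ord0 j - v x ord0 j = 0)) => [x|].
  split=> [h|-> j]; last by rewrite subrr.
  by apply/rowP => j; apply: subr0_eq.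
by apply: dfn_algebraic => j; polyt.
Qed.

Lemma dfn_true n : dfn (fun _ : 'rV[R]_n => True).
Proof. by apply: dfn_iff (@dfn_eq0 n _ (polyfun_cst _ 0)) => x. Qed.

Lemma dfn_false n : dfn (fun _ : 'rV[R]_n => False).
Proof. by apply: dfn_iff (structure_setC HS (dfn_true n)) => x; split => // h; apply: h. Qed.

(** An existential quantifier is a projection, and the projection to the first block is the linear
    map with matrix [col_mx 1%:M 0], under whose images structures are closed. *)
Lemma dfn_ex n m (P : 'rV[R]_n -> 'rV[R]_m -> Prop) :
  dfn (fun z : 'rV_(n + m) => P (lsubmx z) (rsubmx z)) ->
  dfn (fun x => exists v, P x v).
Proof.
move=> h; have /= := structure_affine HS (col_mx 1%:M 0 : 'M[R]_(n + m, n)) 0 h.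
congr (S _); apply/seteqP; split=> x /=.
  case=> z hz <-; exists (rsubmx z).
  by rewrite addr0 -[z in z *m _]hsubmxK mul_row_col mulmx1 mulmx0 addr0.
case=> v hv; exists (row_mx x v); first by rewrite /= row_mxKl row_mxKr; exact: hv.
by rewrite mul_row_col mulmx1 mulmx0 !addr0.
Qed.

Lemma dfn_exR n (P : 'rV[R]_n -> R -> Prop) :
  dfn (fun z : 'rV_(n + 1) => P (lsubmx z) (rsubmx z ord0 ord0)) ->
  dfn (fun x => exists s, P x s).
Proof.
move=> h; apply: dfn_iff (dfn_ex (P := fun x v => P x (v ord0 ord0)) h) => x.
by split=> [[v hv]|[s hs]]; [exists (v ord0 ord0)|exists (const_mx s); rewrite mxE].
Qed.

(** The axioms give images, not preimages. A preimage is the projection of the part of the algebraic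
    set [v = u x] on which [A v] holds. *)
Lemma dfn_pre n m (A : set 'rV[R]_m) (u : 'rV[R]_n -> 'rV_m) : S A -> polymap u ->
  dfn (fun x => A (u x)).
Proof.
move=> hA hu; apply: (@dfn_iff _ (fun x => exists v, A v /\ v = u x)) => [x|].
  by split=> [[v [? <-]]|]//; exists (u x).
apply: dfn_ex; apply: dfn_and; last by apply: dfn_eqv; polyt.
apply: dfn_iff (structure_prod HS (dfn_true n) hA) => z.
by split=> [[]|].
Qed.

Lemma dfn_ge0 n (g : 'rV[R]_n -> R) : polyfun g -> dfn (fun x => 0 <= g x).
Proof.
move=> hg; have h := structure_halfspace HS (fun _ : 'I_1 => 1) 0.
have hu : polymap (fun x => const_mx (g x) : 'rV_1) by polyt.
apply: dfn_iff (dfn_pre h hu) => x /=.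
by rewrite big_ord1 mxE mul1r addr0.
Qed.

Lemma dfn_le n (g h : 'rV[R]_n -> R) : polyfun g -> polyfun h -> dfn (fun x => g x <= h x).
Proof.
move=> hg hh; apply: (@dfn_iff _ (fun x => 0 <= h x - g x)) => [x|].
  by rewrite subr_ge0.
by apply: dfn_ge0; polyt.
Qed.

Lemma dfn_exn n k (P : nat -> 'rV[R]_n -> Prop) :
  (forall i, (i < k)%N -> dfn (P i)) -> dfn (fun x => exists2 i, (i < k)%N & P i x).
Proof.
elim: k => [|k IH] h.
  by apply: dfn_iff (dfn_false n) => x; split=> // -[].
have h1 := IH (fun i ik => h i (ltnW ik)).
apply: dfn_iff (dfn_or h1 (h k (ltnSn k))) => x; split=> [[[i ik ?]|?]|[i]].
- by exists i => //; apply: ltnW.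
- by exists k.
- by rewrite ltnS leq_eqVlt => /orP[/eqP->|ik Px]; [right|left; exists i].
Qed.

Lemma dfn_graph n m k (A : set 'rV[R]_n) (f : 'rV_n -> 'rV_m)
  (u : 'rV[R]_k -> 'rV_n) (v : 'rV[R]_k -> 'rV_m) :
  S (graph A f) -> polymap u -> polymap v -> dfn (fun x => A (u x) /\ v x = f (u x)).
Proof.
move=> h hu hv; have hw := polymap_row_mx hu hv.
apply: dfn_iff (dfn_pre h hw) => x; split.
  by case=> y Ay /eq_row_mx[<- <-].
by case=> Au ->; exists (u x).
Qed.

Lemma dfn_graph1 n k (A : set 'rV[R]_n) (f : 'rV_n -> R)
  (u : 'rV[R]_k -> 'rV_n) (v : 'rV[R]_k -> R) :
  S (graph1 A f) -> polymap u -> polyfun v -> dfn (fun x => A (u x) /\ v x = f (u x)).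
Proof.
move=> h hu hv; have hw : polymap (fun x => const_mx (v x) : 'rV_1) by polyt.
apply: dfn_iff (dfn_graph h hu hw) => x; split=> -[Au].
  by move=> /(congr1 (fun v : 'rV_1 => v ord0 ord0)); rewrite !mxE.
by move=> ->.
Qed.

Lemma graph_dfn n m (A : set 'rV[R]_n) (f : 'rV_n -> 'rV_m) :
  dfn (fun z : 'rV_(n + m) => A (lsubmx z) /\ rsubmx z = f (lsubmx z)) -> S (graph A f).
Proof.
rewrite /dfn (_ : mkset _ = graph A f)//; apply/seteqP; split=> z /=.
  by case=> Az e; exists (lsubmx z) => //; rewrite -e hsubmxK.
by case=> x Ax <-; rewrite row_mxKl row_mxKr.
Qed.

Lemma graph1_dfn n (A : set 'rV[R]_n) (f : 'rV_n -> R) :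
  dfn (fun z : 'rV_(n + 1) => A (lsubmx z) /\ rsubmx z ord0 ord0 = f (lsubmx z)) ->
  S (graph1 A f).
Proof.
move=> h; apply: graph_dfn; apply: dfn_iff h => z; split=> -[Az e]; split=> //.
  by apply/rowP => j; rewrite ord1 [RHS]mxE.
by rewrite e mxE.
Qed.

End Definable.

(** * Compact relations and continuity *)

Section General.

Lemma within_id (T : topologicalType) (A : set T) : {within A, continuous (fun x : T => x)}.
Proof. by apply: continuous_subspaceT => x; exact: cvg_id. Qed.

Lemma within_comp (T U V : topologicalType) (A : set T) (B : set U) (f : T -> U) (g : U -> V) :
  {within B, continuous g} -> {within A, continuous f} -> (forall x, A x -> B (f x)) ->
  {within A, continuous (fun x => g (f x))}.
Proof.
rewrite !subspace_continuousP => cg cf AB x Ax W hW.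
have h1 := cf x Ax _ (cg (f x) (AB _ Ax) W hW).
rewrite /= /nbhs /= /within /= in h1 *.
by apply: filterS h1 => z h Az; apply: h => //; exact: AB.
Qed.

Lemma within_pair (T U V : topologicalType) (A : set T) (f : T -> U) (g : T -> V) :
  {within A, continuous f} -> {within A, continuous g} ->
  {within A, continuous (fun x => (f x, g x))}.
Proof.
by rewrite !subspace_continuousP => cf cg x Ax; apply: cvg_pair; [exact: cf|exact: cg].
Qed.

Lemma continuous_pair (T U V : topologicalType) (f : T -> U) (g : T -> V) :
  continuous f -> continuous g -> continuous (fun x => (f x, g x)).
Proof. by move=> cf cg x; apply: cvg_pair; [exact: cf|exact: cg]. Qed.

Lemma continuous_fst (T U : topologicalType) : continuous (fun z : T * U => z.1).
Proof. by move=> z; exact: cvg_fst. Qed.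

Lemma continuous_snd (T U : topologicalType) : continuous (fun z : T * U => z.2).
Proof. by move=> z; exact: cvg_snd. Qed.

Lemma continuous_compose (T U V : topologicalType) (f : T -> U) (g : U -> V) :
  continuous g -> continuous f -> continuous (fun x => g (f x)).
Proof. by move=> cg cf x; exact: (@continuous_comp _ _ _ f g x (cf x) (cg (f x))). Qed.

Lemma continuous_proj1 (T U V : topologicalType) (f : T -> U * V) :
  continuous f -> continuous (fun x => (f x).1).
Proof. exact/continuous_compose/continuous_fst. Qed.

Lemma continuous_proj2 (T U V : topologicalType) (f : T -> U * V) :
  continuous f -> continuous (fun x => (f x).2).
Proof. exact/continuous_compose/continuous_snd. Qed.

(** The graph of [f] over [A] is compact; a closed condition on its second coordinate keeps it so,
    and the first projection of what remains is the set in question. *)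
Lemma compact_preimage (T U : topologicalType) (A : set T) (B : set U) (f : T -> U) :
  compact A -> {within A, continuous f} -> closed B -> compact (A `&` f @^-1` B).
Proof.
move=> cA cf cB.
have cid : {within A, continuous (fun x : T => x)} by exact: within_id.
have cg := continuous_compact (within_pair cid cf) cA.
have clB : closed (snd @^-1` B : set (T * U)).
  by apply: (continuous_closedP _).1 => //; exact: continuous_snd.
have := continuous_compact (continuous_subspaceT (@continuous_fst T U)) (compact_closedI cg clB).
congr compact; apply/seteqP; split=> x /=.
  by case=> -[_ _] [[y Ay [<- <-]] /= By] <-.
by case=> Ax Bx; exists (x, f x) => //; split=> //; exists x.
Qed.

(** The points of [A] near [x] that [f] sends outside an open [Q] around [f x] form the projection
    of a compact set, which is closed and misses [x]. Compactness is asked only locally because the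
    graph of the flow is compact only over bounded times. *)
Lemma continuous_of_compact_graph (T U : topologicalType) (A : set T) (f : T -> U) :
  hausdorff_space T ->
  (forall x, A x -> exists2 V, nbhs x V & compact [set (z, f z) | z in A `&` V]) ->
  {within A, continuous f}.
Proof.
move=> hT h; apply/subspace_continuousP => x Ax W hW.
have hW' : nbhs (f x) W by [].
rewrite nbhsE in hW'; have [Q [oQ Qfx] QW] := hW'.
have [V nV cK] := h x Ax.
have clQ : closed (snd @^-1` (~` Q) : set (T * U)).
  by apply: (continuous_closedP _).1; [exact: continuous_snd|exact: open_closedC].
have cI := continuous_compact (continuous_subspaceT (@continuous_fst T U)) (compact_closedI cK clQ).
have := compact_closed hT cI; set F := (X in closed X) => clF.
have nF : nbhs x (~` F).
  apply: open_nbhs_nbhs; split; first exact: closed_openC.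
  by case=> -[_ _] [[y [Ay Vy] [<- <-]] /= nQ] e; apply: nQ; rewrite /= in e; rewrite e.
rewrite /= /nbhs /= /within /=.
apply: filterS (filterI nV nF) => z [Vz nFz] Az; apply: QW.
by apply: contrapT => nOz; apply: nFz; exists (z, f z) => //; split=> //; exists z.
Qed.

Lemma continuous_of_compact_graph1 (T U : topologicalType) (A : set T) (f : T -> U) :
  hausdorff_space T -> compact [set (z, f z) | z in A] -> {within A, continuous f}.
Proof.
move=> hT h; apply: continuous_of_compact_graph => // x Ax.
by exists setT; [exact: filterT|rewrite setIT].
Qed.

Lemma compact_bigUn (T : topologicalType) k (P : nat -> set T) :
  (forall i, (i < k)%N -> compact (P i)) ->
  compact [set x | exists2 i, (i < k)%N & P i x].
Proof.
elim: k => [|k IH] h.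
  have -> : [set x | exists2 i, (i < 0)%N & P i x] = set0 by apply/seteqP; split=> x // -[].
  exact: compact0.
have := compactU (IH (fun i ik => h i (ltnW ik))) (h k (ltnSn k)).
congr compact; apply/seteqP; split=> x /=.
  by case=> [[i ik Px]|Px]; [exists i => //; exact: ltnW|exists k].
by case=> i; rewrite ltnS leq_eqVlt => /orP[/eqP->|ik] Px; [right|left; exists i].
Qed.

(** The graph of [g] over [B] is that of [f] over [A] with the factors exchanged, hence compact. *)
Lemma within_inverse (T U : topologicalType) (A : set T) (B : set U) (f : T -> U) (g : U -> T) :
  hausdorff_space U -> compact A -> {within A, continuous f} ->
  (forall x, A x -> g (f x) = x) -> f @` A = B -> {within B, continuous g}.
Proof.
move=> hU cA cf gK <-; apply: continuous_of_compact_graph1 => //.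
have cid : {within A, continuous (fun x : T => x)} by exact: within_id.
have := continuous_compact (within_pair cf cid) cA.
congr compact; apply/seteqP; split=> -[u v] /=.
  by case=> x Ax [<- <-]; exists (f x); [exists x|rewrite gK].
by case=> _ [x Ax <-] [<- <-]; exists x; rewrite ?gK.
Qed.

End General.

Section Arithmetic.
Variables (R : realType) (T : topologicalType).
Implicit Types (A : set T) (f g : T -> R).

Lemma continuous_add f g : continuous f -> continuous g -> continuous (fun x => f x + g x).
Proof. by move=> cf cg x; exact: (continuousD (cf x) (cg x)). Qed.

Lemma continuous_opp f : continuous f -> continuous (fun x => - f x).
Proof. by move=> cf x; exact: (continuousN (cf x)). Qed.

Lemma within_add A f g : {within A, continuous f} -> {within A, continuous g} ->
  {within A, continuous (fun x => f x + g x)}.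
Proof. by move=> cf cg x; exact: (continuousD (cf x) (cg x)). Qed.

Lemma within_opp A f : {within A, continuous f} -> {within A, continuous (fun x => - f x)}.
Proof. by move=> cf x; exact: (continuousN (cf x)). Qed.

Lemma within_mul A f g : {within A, continuous f} -> {within A, continuous g} ->
  {within A, continuous (fun x => f x * g x)}.
Proof. by move=> cf cg x; exact: (continuousM (cf x) (cg x)). Qed.

Lemma within_cst (U : topologicalType) A (c : U) : {within A, continuous (fun _ : T => c)}.
Proof. by apply: continuous_subspaceT => x; exact: cst_continuous. Qed.

End Arithmetic.

Section Matrices.
Variable R : realType.

Lemma continuous_rV (T : topologicalType) n (f : T -> 'rV[R]_n) :
  (forall j, continuous (fun x => f x ord0 j)) -> continuous f.
Proof.
move=> h x; apply/cvg_ballP => e e0.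
have : \forall z \near x, forall j, ball (f x ord0 j) e (f z ord0 j).
  by apply: filter_forall => j; have /cvg_ballP/(_ _ e0) := h j x.
by apply: filterS => z hz; split=> // i j; rewrite ord1.
Qed.

Lemma continuous_coord n (j : 'I_n) : continuous (fun x : 'rV[R]_n => x ord0 j).
Proof. exact: coord_continuous. Qed.

Lemma continuous_row_mx n m :
  continuous (fun z : 'rV[R]_n * 'rV[R]_m => row_mx z.1 z.2).
Proof.
apply: continuous_rV => j; case: (splitP j) => i e.
  have -> : j = lshift m i by exact: val_inj.
  under eq_fun do rewrite row_mxEl.
  exact: continuous_compose (@continuous_coord _ _) (@continuous_fst _ _).
have -> : j = rshift n i by exact: val_inj.
under eq_fun do rewrite row_mxEr.
exact: continuous_compose (@continuous_coord _ _) (@continuous_snd _ _).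
Qed.

Lemma continuous_const_mx : continuous (fun h : R => const_mx h : 'rV[R]_1).
Proof. by apply: continuous_rV => j; under eq_fun do rewrite mxE; move=> x; exact: cvg_id. Qed.

Lemma continuous_lsubmx n m : continuous (fun z : 'rV[R]_(n + m) => lsubmx z).
Proof. by apply: continuous_rV => j; under eq_fun do rewrite mxE; exact: continuous_coord. Qed.

Lemma closed_eq_rV (T : topologicalType) n (f g : T -> 'rV[R]_n) :
  continuous f -> continuous g -> closed [set x | f x = g x].
Proof.
move=> cf cg.
have -> : [set x | f x = g x] = (fun x => f x - g x) @^-1` [set 0].
  by apply/seteqP; split=> x /=; [move->; rewrite subrr|move/subr0_eq].
apply: (continuous_closedP _).1; first by move=> x; apply: continuousB; [exact: cf|exact: cg].
by apply: compact_closed => //; exact: compact_set1.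
Qed.

(** The relation is a continuous image of the parameters [(y, (h, (h', t)))], which range over a
    compact set cut by a closed equation. In its polynomial form that equation is continuous also
    where [a y = 0] and [h = 1]. *)
Lemma compact_slide n m (Y : set 'rV[R]_n) (G : 'rV[R]_n -> R -> 'rV[R]_m)
    (a : 'rV[R]_n -> R) (M : R) :
  compact Y ->
  {within [set z : 'rV[R]_n * R | Y z.1 /\ 0 <= z.2 <= 1], continuous (fun z => G z.1 z.2)} ->
  {within Y, continuous a} ->
  compact [set p : R * ('rV[R]_m * 'rV[R]_m) | 0 <= p.1 <= M /\ exists y h h',
    [/\ Y y, 0 <= h <= 1, 0 <= h' <= 1 &
      [/\ p.2.1 = G y h, p.2.2 = G y h' &
          p.1 * (1 + a y - h) * (1 + a y - h') = (1 + a y) * (h - h')]]].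
Proof.
move=> cY cG ca.
pose D : set ('rV[R]_n * (R * (R * R))) :=
  Y `*` (`[(0 : R), 1] `*` (`[(0 : R), 1] `*` `[(0 : R), M])).
have cD : compact D.
  by do 3?apply: compact_setX => //; exact: segment_compact.
have Dy (z : _) : D z -> Y z.1 by case.
have cfst (T U : topologicalType) (A : set (T * U)) : {within A, continuous (fun z => z.1)}.
  exact/continuous_subspaceT/continuous_fst.
have cy : {within D, continuous (fun z => z.1)} by [].
have c2 : continuous (fun z : 'rV[R]_n * (R * (R * R)) => z.2) by exact: continuous_snd.
have ch : {within D, continuous (fun z => z.2.1)}.
  by apply: continuous_subspaceT; exact: continuous_proj1.
have ch' : {within D, continuous (fun z => z.2.2.1)}.
  by apply: continuous_subspaceT; apply: continuous_proj1; exact: continuous_proj2.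
have ct : {within D, continuous (fun z => z.2.2.2)}.
  by apply: continuous_subspaceT; apply: continuous_proj2; exact: continuous_proj2.
have caD : {within D, continuous (fun z => a z.1)} by apply: within_comp ca cy Dy.
have cF : {within D, continuous (fun z => z.2.2.2 * (1 + a z.1 - z.2.1) * (1 + a z.1 - z.2.2.1)
    - (1 + a z.1) * (z.2.1 - z.2.2.1))}.
  have c0 : {within D, continuous (fun _ => 1 : R)} by exact: within_cst.
  have c1 := within_add c0 caD.
  have c5 := within_add c1 (within_opp ch).
  have c3 := within_add c1 (within_opp ch').
  have c4 := within_add ch (within_opp ch').
  exact: (within_add (within_mul (within_mul ct c5) c3) (within_opp (within_mul c1 c4))).
have cl0 : closed [set (0 : R)] by apply: compact_closed => //; exact: compact_set1.
have := compact_preimage cD cF cl0; set K := (X in compact X) => cK.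
have KD : K `<=` D by move=> z [].
have cI (f : _ -> R) : {within D, continuous f} -> {within K, continuous f}.
  by apply: continuous_subspaceW.
have Dh z : K z -> Y z.1 /\ 0 <= z.2.1 <= 1.
  by case=> -[? [+ _]] _; rewrite /= in_itv.
have Dh' z : K z -> Y z.1 /\ 0 <= z.2.2.1 <= 1.
  by case=> -[? [_ [+ _]]] _; rewrite /= in_itv.
have cG1 : {within K, continuous (fun z => G z.1 z.2.1)}.
  apply: (within_comp (f := fun z => (z.1, z.2.1)) cG _ Dh); apply: within_pair; first exact: cfst.
  exact: cI.
have cG2 : {within K, continuous (fun z => G z.1 z.2.2.1)}.
  apply: (within_comp (f := fun z => (z.1, z.2.2.1)) cG _ Dh').
  by apply: within_pair; [exact: cfst|exact: cI].
have := continuous_compact (within_pair (cI _ ct) (within_pair cG1 cG2)) cK.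
congr compact; apply/seteqP; split=> -[t [x x']] /=.
  case=> -[y [h [h' t']]] [[/= Yy [hb [hb' tb]]] /= e] [<- <- <-].
  split; first by move: tb; rewrite in_itv.
  exists y, h, h'; rewrite !in_itv /= in hb hb'; split=> //; split=> //.
  exact: subr0_eq.
case=> tb [y [h [h' [Yy hb hb' [-> -> e]]]]].
exists (y, (h, (h', t))) => //; split; last by rewrite /= e subrr.
by rewrite /D /= !in_itv.
Qed.

(** * Compact relations with a time parameter *)

Section Relations.
Variable n : nat.
Notation E := 'rV[R]_n.

(** In the product of [K1] and [K2], agreement of the two middle points is a closed condition;
    forgetting that point and adding the times is continuous. *)
Lemma compact_compose (K1 K2 : set (R * (E * E))) : compact K1 -> compact K2 ->
  compact [set p : R * (E * E) | exists s r y,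
    [/\ K1 (s, (p.2.1, y)), K2 (r, (y, p.2.2)) & p.1 = s + r]].
Proof.
move=> c1 c2.
pose T := ((R * (E * E)) * (R * (E * E)))%type.
have p1 : continuous (fun z : T => z.1) by exact: continuous_fst.
have p2 : continuous (fun z : T => z.2) by exact: continuous_snd.
have p12 := continuous_proj2 p1; have p22 := continuous_proj2 p2.
have cl : closed [set z : T | z.1.2.2 = z.2.2.1].
  exact: (closed_eq_rV (continuous_proj2 p12) (continuous_proj1 p22)).
have cf : continuous (fun z : T => (z.1.1 + z.2.1, (z.1.2.1, z.2.2.2))).
  have cD := continuous_add (continuous_proj1 p1) (continuous_proj1 p2).
  exact: (continuous_pair cD (continuous_pair (continuous_proj1 p12) (continuous_proj2 p22))).
have := continuous_compact (continuous_subspaceT cf) (compact_closedI (compact_setX c1 c2) cl).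
congr compact; apply/seteqP; split=> -[t [x z]] /=.
  case=> -[[s [x' y]] [r [y' z']]] [[/= k1 k2] /= e] [<- <- <-].
  by exists s, r, y; split=> //; rewrite e.
case=> s [r [y [k1 k2 ->]]].
by exists ((s, (x, y)), (r, (y, z))).
Qed.

Lemma compact_swap (K : set (R * (E * E))) : compact K ->
  compact [set p : R * (E * E) | K (p.1, (p.2.2, p.2.1))].
Proof.
move=> cK.
have p1 : continuous (fun z : R * (E * E) => z.1) by exact: continuous_fst.
have p2 : continuous (fun z : R * (E * E) => z.2) by exact: continuous_snd.
have cf := continuous_pair p1 (continuous_pair (continuous_proj2 p2) (continuous_proj1 p2)).
have := continuous_compact (continuous_subspaceT cf) cK.
congr compact; apply/seteqP; split=> -[t [x z]] /=.
  by case=> -[t' [x' z']] k [<- <- <-].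
by move=> k; exists (t, (z, x)).
Qed.

Lemma compact_opp_time (K : set (R * (E * E))) : compact K ->
  compact [set p : R * (E * E) | K (- p.1, p.2)].
Proof.
move=> cK.
have p1 : continuous (fun z : R * (E * E) => z.1) by exact: continuous_fst.
have p2 : continuous (fun z : R * (E * E) => z.2) by exact: continuous_snd.
have cf := continuous_pair (continuous_opp p1) p2.
have := continuous_compact (continuous_subspaceT cf) cK.
congr compact; apply/seteqP; split=> -[t x] /=.
  by case=> -[t' x'] k [<- <-]; rewrite opprK.
by move=> k; exists (- t, x) => //=; rewrite opprK.
Qed.

Lemma compact_time_le (K : set (R * (E * E))) (M : R) : compact K ->
  compact [set p : R * (E * E) | K p /\ p.1 <= M].
Proof.
move=> cK; apply: compact_closedI => //.
apply: (@closed_comp _ _ (fun p : R * (E * E) => p.1) [set x | x <= M]).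
  by move=> z _; exact: continuous_fst.
exact: closed_le.
Qed.

End Relations.

End Matrices.

(** * The half-strands of a weighted chain *)

(** The spaces of a chain live in different dimensions, so their points are compared in sigma types
    over [nat]; decidable equality of the index recovers the second component. *)
Lemma existT_nat_inj (P : nat -> Type) i (x y : P i) : existT P i x = existT P i y -> x = y.
Proof.
by apply: Eqdep_dec.inj_pair2_eq_dec => a b; case: (eqVneq a b) => h; [left|right; apply/eqP].
Qed.

Section ChainStrands.
Variables (R : realType) (N : nat) (X : set 'rV[R]_N) (C : chain R).
Hypothesis chain_C : weighted_chain C.
Variable q : glue_point C -> 'rV[R]_N.
Hypothesis space_C : associated_space X q.
Notation n := (len C).
Notation Yset i := (@Ysp R C i).
Notation Xset i := (@Xsp R C i).
Notation Lset i := (@loc R C i).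
Notation BaseP i := (@Base R C i).
Notation RhoP i := (@CylRho R C i).
Notation LamP i := (@CylLam R C i).

(** Picks one point of each gluing class, so that equality under [q] becomes equality of terms: ends
    move to the base, the common middle moves to the [CylRho] side. *)
Definition glue_nf (p : glue_point C) : glue_point C :=
  match p with
  | Base _ _ => p
  | CylLam i y t => if t == 1 then Base (lam y) else if t == 0 then RhoP i.+1 y 0 else p
  | CylRho i y t => if t == 1 then Base (rho y) else p
  end.

Definition glue_level (p : glue_point C) : R :=
  match p with
  | Base i _ => i%:R
  | CylLam i _ t => i%:R + (1 - t) / 2
  | CylRho i _ t => i%:R - (1 - t) / 2
  end.

Lemma clos_glue_invariant (T : Type) (F : glue_point C -> T) p p' :
  (forall p p', Defs.glue p p' -> F p = F p') ->
  Relation_Operators.clos_refl_sym_trans _ (@Defs.glue R C) p p' -> F p = F p'.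
Proof. by move=> h; elim=> [x y /h//|//|x y _ ->//|x y z _ -> _ ->]. Qed.

Lemma glue_nf_invariant p p' : Defs.glue p p' -> glue_nf p = glue_nf p'.
Proof.
case=> [i y _ _|i y _ _|i y _ _] /=; rewrite ?eqxx// (_ : (0 == 1) = false :> bool)//.
by apply/eqP => e; have := @ltr01 R; rewrite e ltxx.
Qed.

Lemma glue_level_invariant p p' : Defs.glue p p' -> glue_level p = glue_level p'.
Proof. by case=> [i y _ _|i y _ _|i y _ _] /=; rewrite -?natr1; field. Qed.

Lemma strand_lt i (y : 'rV_(ydim C i.+1)) : (i <= n)%N -> Yset i.+1 y -> (i < n)%N.
Proof.
rewrite leq_eqVlt => /orP[/eqP e|//] Yy.
case: chain_C => _ [_ h] _.
by subst i; rewrite h in Yy.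
Qed.

Lemma empty_bottom (y : 'rV_(ydim C 0)) : ~ Yset 0 y.
Proof. by case: chain_C => _ [h _] _; rewrite h. Qed.

Lemma rho_X i (y : 'rV_(ydim C i)) : (i <= n)%N -> Yset i y -> Xset i (rho y).
Proof. by case: chain_C => _ _ h /h [[_ _ [f _ _] _ _] _ _ _] /f. Qed.

Lemma lam_X i (y : 'rV_(ydim C i.+1)) : (i <= n)%N -> Yset i.+1 y -> Xset i (lam y).
Proof. by case: chain_C => _ _ h /h [_ [_ _ [f _ _] _ _] _ _] /f. Qed.

Lemma loc_X i (x : 'rV_(xdim C i)) : (i <= n)%N -> Lset i x -> Xset i x.
Proof. by case: chain_C => _ _ h /h [[_ _ _ [_ _ s] _] _ _ _] /s. Qed.

Lemma rho_onto i (x : 'rV_(xdim C i)) : (i <= n)%N -> Xset i x -> ~ Lset i x ->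
  exists2 y, Yset i y & rho y = x.
Proof.
case: chain_C => _ _ h /h [[_ _ _ _ [[_ _ s] _ _]] _ _ _] Xx nL.
by have [y [Yy _] <-] := s x (conj Xx nL); exists y.
Qed.

Lemma lam_onto i (x : 'rV_(xdim C i)) : (i <= n)%N -> Xset i x -> ~ Lset i x ->
  exists2 y, Yset i.+1 y & lam y = x.
Proof.
case: chain_C => _ _ h /h [_ [_ _ _ _ [[_ _ s] _ _]] _ _] Xx nL.
by have [y [Yy _] <-] := s x (conj Xx nL); exists y.
Qed.

Lemma rho_inj i (y y' : 'rV_(ydim C i)) : (i <= n)%N -> Yset i y -> Yset i y' ->
  ~ Lset i (rho y) -> rho y = rho y' -> y = y'.
Proof.
case: chain_C => _ _ h /h [[_ _ _ _ [[_ inj _] _ _]] _ _ _] Yy Yy' nL e.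
by apply: inj => //; rewrite inE; split=> //=; rewrite -e.
Qed.

Lemma lam_inj i (y y' : 'rV_(ydim C i.+1)) : (i <= n)%N -> Yset i.+1 y -> Yset i.+1 y' ->
  ~ Lset i (lam y) -> lam y = lam y' -> y = y'.
Proof.
case: chain_C => _ _ h /h [_ [_ _ _ _ [[_ inj _] _ _]] _ _] Yy Yy' nL e.
by apply: inj => //; rewrite inE; split=> //=; rewrite -e.
Qed.

Lemma wplusP i (x : 'rV_(xdim C i)) : (i <= n)%N -> Xset i x ->
  0 <= wplus x /\ (wplus x = 0 <-> Lset i x).
Proof. by case: chain_C => _ _ h /h [_ _ [_ p z] _] Xx; split; [exact: p|exact: z]. Qed.

Lemma wminusP i (x : 'rV_(xdim C i)) : (i <= n)%N -> Xset i x ->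
  0 <= wminus x /\ (wminus x = 0 <-> Lset i x).
Proof. by case: chain_C => _ _ h /h [_ _ _ [_ p z]] Xx; split; [exact: p|exact: z]. Qed.

Lemma nf_dom p : glue_dom p -> glue_dom (glue_nf p).
Proof.
case: p => [i x|i y t|i y t] //= [ni Yy t01].
  case: ifP => _; first by split=> //; exact: lam_X.
  by case: ifP => _ //; split=> //; [exact: (strand_lt ni Yy)|rewrite lexx ler01].
by case: ifP => _ //; split=> //; exact: rho_X.
Qed.

Lemma q_nf_self p : glue_dom p -> q p = q (glue_nf p).
Proof.
move=> dp; case: space_C => _ h _; apply/(h _ _ dp (nf_dom dp)).
case: p dp => [i x|i y t|i y t] /=; first by move=> _; exact: Relation_Operators.rst_refl.
  case=> ni Yy t01; case: eqP => [->|_].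
    by apply: Relation_Operators.rst_step; exact: glue_lam.
  case: eqP => [->|_]; last exact: Relation_Operators.rst_refl.
  apply: Relation_Operators.rst_step; apply: glue_mid => //.
  exact: (strand_lt ni Yy).
case=> ni Yy t01; case: eqP => [->|_]; last exact: Relation_Operators.rst_refl.
by apply: Relation_Operators.rst_step; exact: glue_rho.
Qed.

Lemma q_eq p p' : glue_dom p -> glue_dom p' -> q p = q p' -> glue_nf p = glue_nf p'.
Proof.
move=> dp dp'; case: space_C => _ h _ /(h _ _ dp dp').
exact/clos_glue_invariant/glue_nf_invariant.
Qed.

Lemma q_X p : glue_dom p -> X (q p).
Proof. by case: space_C => <- _ _ dp; exists p. Qed.

(** Defined through a chosen representative; by [level_q] the choice does not matter, since
    [glue_level] is constant on gluing classes. *)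
Definition level (x : 'rV[R]_N) : R :=
  if pselect (exists2 p, glue_dom p & q p = x) is left e then
    glue_level (projT1 (cid2 e)) else 0.

Lemma level_q p : glue_dom p -> level (q p) = glue_level p.
Proof.
move=> dp; rewrite /level; case: pselect => [e|]; last by case; exists p.
case: (cid2 e) => p' dp' /= e'; case: space_C => _ h _.
exact/(clos_glue_invariant glue_level_invariant)/(h _ _ dp' dp).
Qed.

(** The tag [i] stands for [Ysp C i.+1], whose halves end on [Xsp C i] and [Xsp C i.+1]. As
    [Ysp C 0] is empty, the shift loses no strand. *)
Definition strand := {i : nat & 'rV[R]_(ydim C i.+1)}.

Definition in_strand : set strand := fun y => (tag y < n)%N /\ Yset (tag y).+1 (tagged y).

Definition strand_pt (b : bool) (y : strand) (h : R) : 'rV[R]_N :=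
  if b then q (RhoP (tag y).+1 (tagged y) h) else q (LamP (tag y) (tagged y) h).

#[local] Arguments strand_pt : simpl never.

Definition strand_weight (b : bool) (y : strand) : R :=
  if b then wplus (rho (tagged y)) else wminus (lam (tagged y)).

Definition crit : set 'rV[R]_N := fun x =>
  exists i (z : 'rV_(xdim C i)), [/\ (i <= n)%N, Lset i z & x = q (Base z)].

Definition strand0 : strand := existT _ 0%N (0 : 'rV[R]_(ydim C 1)).

(** With [height_of] and [base_of], a means to read off the components of an equation between normal
    forms whose types depend on the index. Constructors lacking such a component get an arbitrary
    value. *)
Definition strand_of (p : glue_point C) : strand :=
  match p with
  | CylRho i y _ =>
    match i return 'rV_(ydim C i) -> strand with
    | 0%N => fun=> strand0
    | j.+1 => fun y => existT _ j y
    end y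
  | CylLam i y _ => existT _ i y
  | _ => strand0
  end.

Definition height_of (p : glue_point C) : R :=
  match p with CylRho _ _ t => t | CylLam _ _ t => t | _ => 0 end.

Definition base_of (p : glue_point C) : {i : nat & 'rV[R]_(xdim C i)} :=
  match p with Base i x => existT _ i x | _ => existT _ 0%N (0 : 'rV[R]_(xdim C 0)) end.

Lemma Base_inj i (x x' : 'rV_(xdim C i)) : Base x = Base x' -> x = x'.
Proof. by move=> /(congr1 base_of) /= e; exact: (existT_nat_inj e). Qed.

Lemma q_Base_inj i (x x' : 'rV_(xdim C i)) : (i <= n)%N -> Xset i x -> Xset i x' ->
  q (Base x) = q (Base x') -> x = x'.
Proof. by move=> ni Xx Xx' /q_eq /= /(_ (conj ni Xx) (conj ni Xx'))/Base_inj. Qed.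

Lemma crit_Base i (x : 'rV_(xdim C i)) : (i <= n)%N -> Xset i x ->
  crit (q (Base x)) <-> Lset i x.
Proof.
move=> ni Xx; split=> [[i' [z [ni' Lz e]]]|Lx]; last by exists i, x.
have dz : glue_dom (Base z) by split=> //; exact: loc_X.
have /= := q_eq (conj ni Xx : glue_dom (Base x)) dz e.
move=> /(congr1 base_of) /= e'.
have ei : i = i' := congr1 (@projT1 _ _) e'.
by subst i'; rewrite (existT_nat_inj e').
Qed.

Lemma dom_rho (y : strand) h : in_strand y -> 0 <= h <= 1 ->
  glue_dom (RhoP (tag y).+1 (tagged y) h).
Proof. by case. Qed.

Lemma dom_lam (y : strand) h : in_strand y -> 0 <= h <= 1 ->
  glue_dom (LamP (tag y) (tagged y) h).
Proof. by case=> /ltnW. Qed.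

Lemma strand_pt_dom b y h : in_strand y -> 0 <= h <= 1 ->
  exists2 p, glue_dom p & strand_pt b y h = q p /\
   glue_nf p = if b then (if h == 1 then Base (rho (tagged y)) else RhoP (tag y).+1 (tagged y) h)
     else (if h == 1 then Base (lam (tagged y)) else if h == 0 then RhoP (tag y).+1 (tagged y) 0
        else LamP (tag y) (tagged y) h).
Proof.
move=> Sy hb; case: b.
  by exists (RhoP (tag y).+1 (tagged y) h); [exact: dom_rho|].
by exists (LamP (tag y) (tagged y) h); [exact: dom_lam|].
Qed.

Lemma strand_pt1 b y : in_strand y -> strand_pt b y 1 =
  if b then q (Base (rho (tagged y))) else q (Base (lam (tagged y))).
Proof.
move=> Sy; have hb : 0 <= (1 : R) <= 1 by lra.
have [p dp [-> e]] := strand_pt_dom b Sy hb.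
by rewrite (q_nf_self dp) e eqxx; case: b e.
Qed.

Lemma level_strand b y h : in_strand y -> 0 <= h <= 1 -> level (strand_pt b y h) =
  (tag y)%:R + (if b then 1 + h else 1 - h) / 2.
Proof.
move=> Sy hb; rewrite /strand_pt; case: b; rewrite level_q//=.
- by rewrite -natr1; field.
- exact: dom_rho.
- exact: dom_lam.
Qed.

Lemma crit_level x : crit x -> exists2 i, (i <= n)%N & level x = i%:R.
Proof.
case=> i [z [ni Lz ->]]; exists i => //; rewrite level_q//.
by split=> //; exact: loc_X.
Qed.

Lemma rho_strand_X (y : strand) : in_strand y -> Xset (tag y).+1 (rho (tagged y)).
Proof. by case=> ? ?; exact: rho_X. Qed.

Lemma lam_strand_X (y : strand) : in_strand y -> Xset (tag y) (lam (tagged y)).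
Proof. by case=> /ltnW ? ?; exact: lam_X. Qed.

Lemma strand_weightP b y : in_strand y -> 0 <= strand_weight b y /\
  (strand_weight b y = 0 <-> crit (strand_pt b y 1)).
Proof.
move=> Sy; have [lt _] := Sy; rewrite strand_pt1// /strand_weight; case: b.
  have Xr := rho_strand_X Sy.
  by have [w0 wz] := wplusP lt Xr; split=> //; rewrite crit_Base.
have Xr := lam_strand_X Sy.
by have [w0 wz] := wminusP (ltnW lt) Xr; split=> //; rewrite crit_Base// ltnW.
Qed.

Lemma natr_half (i j : nat) (r : R) : 0 < r < 1 -> i%:R = j%:R + r -> False.
Proof.
move=> /andP[r0 r1] e.
have : (j%:R : R) < i%:R by rewrite e; lra.
have : (i%:R : R) < j.+1%:R by rewrite e -natr1; lra.
by rewrite !ltr_nat ltnS => ij /(leq_ltn_trans ij); rewrite ltnn.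
Qed.

(** A critical point has a [Base] as normal form, and a point of a strand has one only at height
    [1]. *)
Lemma crit_strand_pt b y h : in_strand y -> 0 <= h <= 1 ->
  crit (strand_pt b y h) <-> (h = 1 /\ strand_weight b y = 0).
Proof.
move=> Sy hb; split; last by case=> -> /(strand_weightP b Sy).2.
move=> c; have e : h = 1; last first.
  by split=> //; apply/(strand_weightP b Sy).2; rewrite -e.
case: c => i [z [ni Lz]].
have [p dp [-> e]] := strand_pt_dom b Sy hb.
have dz : glue_dom (Base z) by split=> //; exact: loc_X.
move=> /(q_eq dp dz); rewrite e /=.
by case: b e => e; do 2?case: eqP => //.
Qed.

Lemma strand_eta (y : strand) : existT (fun i => 'rV[R]_(ydim C i.+1)) (tag y) (tagged y) = y.
Proof. by case: y. Qed.

(** Below height [1] the normal form remembers strand and height. At height [1] both points are base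
    points, and off the blowup locus the blowdown is injective. *)
Lemma strand_inj_aux b y h y' h' : in_strand y -> in_strand y' -> 0 <= h <= 1 -> 0 <= h' <= 1 ->
  ~ crit (strand_pt b y h) -> strand_pt b y h = strand_pt b y' h' -> y = y' /\ h = h'.
Proof.
move=> Sy Sy' hb hb' nc e.
have [p dp [ep np]] := strand_pt_dom b Sy hb.
have [p' dp' [ep' np']] := strand_pt_dom b Sy' hb'.
have := q_eq dp dp'; rewrite -ep -ep' np np' => /(_ e).
have [lt Yy] := Sy; have [lt' Yy'] := Sy'.
have aux i (z z' : 'rV_(ydim C i.+1)) : z = z' ->
  existT (fun i => 'rV[R]_(ydim C i.+1)) i z = existT _ i z' by move->.
case: b ep ep' np np' nc e => ep ep' np np' nc e.
  case: eqP => [h1|h1]; case: eqP => [h1'|h1'] // E; last first.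
    have := congr1 strand_of E; have := congr1 height_of E => /= ->.
    by rewrite !strand_eta.
  split; last by rewrite h1 h1'.
  rewrite h1 strand_pt1// crit_Base// in nc; last exact: rho_strand_X.
  case: y y' Sy Sy' lt Yy lt' Yy' E nc {ep ep' np np' e}
    => [i y] [i' y'] /= _ _ lt Yy lt' Yy' /(congr1 base_of) /= e.
  have /succn_inj ei : i.+1 = i'.+1 := congr1 (@projT1 _ _) e.
  by subst i' => nL; apply: aux; apply: rho_inj nL (existT_nat_inj e).
have h01 : (0 : R) <> 1 by apply/eqP; rewrite eq_sym oner_eq0.
case: eqP => [h1|h1]; case: eqP => [h1'|h1'];
  do 2?[case: eqP => ?]; move=> E //; try discriminate E.
- split; last by rewrite h1 h1'.
  rewrite h1 strand_pt1// crit_Base// in nc; [|exact: ltnW|exact: lam_strand_X].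
  case: y y' Sy Sy' lt Yy lt' Yy' E nc {ep ep' np np' e}
    => [i y] [i' y'] /= _ _ lt Yy lt' Yy' /(congr1 base_of) /= e.
  have ei : i = i' := congr1 (@projT1 _ _) e.
  by subst i' => nL; apply: aux; apply: lam_inj nL (existT_nat_inj e) => //; exact: ltnW.
- have := congr1 strand_of E => /=; rewrite !strand_eta => ->.
  by split=> //; congruence.
- have := congr1 strand_of E; have := congr1 height_of E => /= ->.
  by rewrite !strand_eta.
Qed.

Lemma strand_cross_aux y h y' h' : in_strand y -> in_strand y' -> 0 <= h <= 1 -> 0 <= h' <= 1 ->
  strand_pt true y h = strand_pt false y' h' -> (h = 0 /\ h' = 0) \/ (h = 1 /\ h' = 1).
Proof.
move=> Sy Sy' hb hb' e.
have [p dp [ep np]] := strand_pt_dom true Sy hb.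
have [p' dp' [ep' np']] := strand_pt_dom false Sy' hb'.
have := q_eq dp dp'; rewrite -ep -ep' np np' => /(_ e).
case: eqP => [h1|h1]; case: eqP => [h1'|h1'] //; try case: eqP => [h2|h2] //.
- by right.
- by move=> /(congr1 height_of) /= ->; left.
Qed.

(** [rho] and [lam] into the same [Xsp] share their blowup locus and both hit every point off it. *)
Lemma strand_end_aux b y : in_strand y -> ~ crit (strand_pt b y 1) ->
  exists2 y', in_strand y' & strand_pt (~~ b) y' 1 = strand_pt b y 1.
Proof.
case: y b => i y [] Sy nc; have [/= lt Yy] := Sy; rewrite strand_pt1//= in nc *.
  have Xr : Xset i.+1 (rho y) := rho_strand_X Sy.
  rewrite crit_Base// in nc.
  have [y' Yy' e] := lam_onto lt Xr nc.
  have S' : in_strand (existT _ i.+1 y') by split=> //=; exact: strand_lt lt Yy'.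
  by exists (existT _ i.+1 y') => //; rewrite strand_pt1//= e.
have Xr : Xset i (lam y) := lam_strand_X Sy.
rewrite crit_Base// in nc; last exact: ltnW.
have [y' Yy' e] := rho_onto (ltnW lt) Xr nc.
(* At index [0] the source of [rho] is empty, so [Xsp C 0] has no point off the locus. *)
case: i y Sy lt Yy Xr nc y' Yy' e => [|i] y Sy lt Yy Xr nc y' Yy' e.
  by have := empty_bottom Yy'.
have S' : in_strand (existT _ i y') by split=> //=; exact: ltnW.
by exists (existT _ i y') => //; rewrite strand_pt1//= e.
Qed.

Lemma strand_mid_aux y : in_strand y -> strand_pt true y 0 = strand_pt false y 0.
Proof.
move=> Sy; have hb : 0 <= (0 : R) <= 1 by lra.
have [p dp [-> np]] := strand_pt_dom true Sy hb.
have [p' dp' [-> np']] := strand_pt_dom false Sy hb.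
rewrite (q_nf_self dp) (q_nf_self dp') np np' eqxx.
by rewrite eq_sym oner_eq0.
Qed.

Lemma strand_cover_aux x : X x -> crit x \/
  exists b y h, [/\ in_strand y, 0 <= h <= 1 & x = strand_pt b y h].
Proof.
case: space_C => <- _ _ [[i x'|i y t|i y t] /=].
- case=> ni Xx <-; have [Lx|nL] := pselect (Lset i x').
    by left; exists i, x'.
  right; have [y Yy e] := rho_onto ni Xx nL.
  case: i ni x' Xx nL y Yy e => [|i] ni x' Xx nL y Yy e.
    by have := empty_bottom Yy.
  have S' : in_strand (existT _ i y) by [].
  exists true, (existT _ i y), 1; split=> //; first by lra.
  by rewrite strand_pt1//= e.
- case=> ni Yy t01 <-; right; exists false, (existT _ i y), t; split=> //.
  by split=> //=; exact: strand_lt ni Yy.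
- case=> ni Yy t01 <-; right.
  case: i ni y Yy => [|i] ni y Yy; first by have := empty_bottom Yy.
  by exists true, (existT _ i y), t.
Qed.

Lemma chain_strand_system :
  strand_system X crit in_strand n strand_pt strand_weight (fun y => tag y).
Proof.
split.
- by move=> x [i [z [ni Lz ->]]]; apply: q_X; split=> //; exact: loc_X.
- by move=> b y h Sy hb; have [p dp [-> _]] := strand_pt_dom b Sy hb; exact: q_X.
- exact: strand_cover_aux.
- exact: strand_mid_aux.
- by move=> b y Sy; case: (strand_weightP b Sy).
- exact: crit_strand_pt.
- exact: strand_inj_aux.
- by move=> y h y' h' Sy Sy' hb hb' _; exact: strand_cross_aux.
- exact: strand_end_aux.
(* Computing [level] at the common end from both strands gives [tag y + 1 = tag y']. *)
- move=> y y' Sy Sy' _ /(congr1 level); rewrite !level_strand//; try lra.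
  move=> e; have : ((tag y)%:R : R) < (tag y')%:R by lra.
  by rewrite ltr_nat.
- by move=> y [/ltnW].
Qed.

End ChainStrands.

Lemma dfn_finite (R : realType) (S : sets_of_Rn R) (HS : is_structure S) n (A : set 'rV[R]_n) :
  finite_set A -> S n A.
Proof.
case/finite_seqP => s ->; elim: s => [|c s IH].
  have := @dfn_false _ _ HS n; congr (S _); apply/seteqP; split=> x //=.
have h := dfn_eqv HS (@polymap_id R n) (polymap_cst n c).
have := dfn_or HS h IH; congr (S _); apply/seteqP; split=> x /=; rewrite in_cons.
  by case=> [->|->]; rewrite ?eqxx ?orbT.
by case/orP => [/eqP|]; [left|right].
Qed.

Lemma cylP (R : realType) m (Y : set 'rV[R]_m) (y : 'rV[R]_m) (h : R) :
  cyl Y (row_mx y (const_mx h)) <-> Y y /\ 0 <= h <= 1.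
Proof. by rewrite /cyl /prod_set /= row_mxKl row_mxKr mxE. Qed.

(** * Motion along one mapping cylinder *)

Section Piece.
Variables (R : realType) (m d k : nat) (Y : set 'rV[R]_m) (G : 'rV[R]_m -> R -> 'rV[R]_k).
Variables (Z : set 'rV[R]_d) (r : 'rV[R]_m -> 'rV[R]_d) (w : 'rV[R]_d -> R).

(** [slide] restricted to the strands of one index, which all live in one space ['rV[R]_m]. The
    weight appears as [w (r y)] because the chain gives it on the base. *)
Definition piece (t : R) (x x' : 'rV[R]_k) := exists y h h',
  [/\ Y y, 0 <= h <= 1, 0 <= h' <= 1 &
    [/\ x = G y h, x' = G y h' & clock (w (r y)) t h h']].

Hypothesis rZ : forall y, Y y -> Z (r y).

Let Gz := fun z : 'rV[R]_(m + 1) => G (lsubmx z) (rsubmx z ord0 ord0).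

Lemma GzE y h : Gz (row_mx y (const_mx h)) = G y h.
Proof. by rewrite /Gz row_mxKl row_mxKr mxE. Qed.

Lemma within_cyl (T : topologicalType) (g : 'rV[R]_(m + 1) -> T) : {within cyl Y, continuous g} ->
  {within [set z : 'rV[R]_m * R | Y z.1 /\ 0 <= z.2 <= 1],
    continuous (fun z => g (row_mx z.1 (const_mx z.2)))}.
Proof.
move=> cg; apply: (within_comp cg) => [|z /cylP//].
apply: continuous_subspaceT.
have c1 : continuous (fun z : 'rV[R]_m * R => z.1) by exact: continuous_fst.
have c2 : continuous (fun z : 'rV[R]_m * R => z.2) by exact: continuous_snd.
have c3 := continuous_pair c1 (continuous_compose (@continuous_const_mx R) c2).
exact: (continuous_compose (@continuous_row_mx R m 1) c3).
Qed.

Lemma within_strand : {within cyl Y, continuous Gz} ->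
  {within [set z : 'rV[R]_m * R | Y z.1 /\ 0 <= z.2 <= 1], continuous (fun z => G z.1 z.2)}.
Proof.
move=> /within_cyl; rewrite (_ : (fun z => G z.1 z.2) =
  fun z => Gz (row_mx z.1 (const_mx z.2)))//.
by apply/funext => z; rewrite GzE.
Qed.

Lemma compact_piece (M : R) : compact Y -> {within cyl Y, continuous Gz} ->
  {within Y, continuous r} -> {within Z, continuous w} ->
  compact [set p : R * ('rV[R]_k * 'rV[R]_k) | 0 <= p.1 <= M /\ piece p.1 p.2.1 p.2.2].
Proof.
move=> cY cG cr cw; apply: compact_slide => //; first exact: within_strand.
exact: (within_comp cw cr rZ).
Qed.

Variables (S : sets_of_Rn R) (HS : is_structure S).

Lemma dfn_strand n (y : 'rV[R]_n -> 'rV[R]_m) (h : 'rV[R]_n -> R) (x : 'rV[R]_n -> 'rV[R]_k) :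
  S (graph (cyl Y) Gz) -> polymap y -> polyfun h -> polymap x ->
  dfn S (fun z => (Y (y z) /\ 0 <= h z <= 1) /\ x z = G (y z) (h z)).
Proof.
move=> hG hy hh hx.
have hu : polymap (fun z => row_mx (y z) (const_mx (h z) : 'rV_1)) by polyt.
by apply: dfn_iff (dfn_graph HS hG hu hx) => z; rewrite GzE cylP.
Qed.

Lemma dfn_piece n (g : 'rV[R]_n -> R) (u v : 'rV[R]_n -> 'rV[R]_k) :
  S (graph (cyl Y) Gz) -> S (graph Y r) -> S (graph1 Z w) ->
  polyfun g -> polymap u -> polymap v -> dfn S (fun z => piece (g z) (u z) (v z)).
Proof.
move=> hG hr hw hg hu hv.
(* [r] and [w] are accessible through their graphs, so their values become quantified variables [b]
   and [c], after which the clock equation is polynomial. *)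
apply: (@dfn_iff _ S _ (fun z => exists y h h' b c,
  [/\ [/\ (Y y /\ 0 <= h <= 1) /\ u z = G y h & (Y y /\ 0 <= h' <= 1) /\ v z = G y h'],
    [/\ Y y /\ b = r y & Z b /\ c = w b] &
    g z * (1 + c - h) * (1 + c - h') = (1 + c) * (h - h')])).
  move=> z; split.
    case=> y [h [h' [b [c [[[[Yy hb] e] [[_ hb'] e']] [[_ ->] [_ ->]] eq]]]]].
    by exists y, h, h'.
  case=> y [h [h' [Yy hb hb' [e e' eq]]]].
  by exists y, h, h', (r y), (w (r y)); split=> //; split=> //; split=> //; exact: rZ.
apply: (dfn_ex HS); do 2 apply: (dfn_exR HS); apply: (dfn_ex HS); apply: (dfn_exR HS).
apply: (dfn_and3 HS); last by apply: (dfn_eq HS); polyt.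
  by apply: (dfn_and HS); apply: dfn_strand => //; polyt.
apply: (dfn_and HS); first by apply: (dfn_graph HS hr); polyt.
by apply: (dfn_graph1 HS hw); polyt.
Qed.

End Piece.

(** * Continuity and tameness of the flow *)

Section ChainFlow.
Variables (R : realType) (N : nat) (X : set 'rV[R]_N) (C : chain R).
Hypothesis chain_C : weighted_chain C.
Variable q : glue_point C -> 'rV[R]_N.
Hypothesis space_C : associated_space X q.
Hypothesis compact_X : compact X.
Hypothesis tame_X : tame X.
Notation n := (len C).
Notation Yset i := (@Ysp R C i).
Notation Xset i := (@Xsp R C i).
Notation Lset i := (@loc R C i).
Notation BaseP i := (@Base R C i).
Notation RhoP i := (@CylRho R C i).
Notation LamP i := (@CylLam R C i).
Notation G := (strand_pt q).
Notation a := (@strand_weight R C).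
Notation S := (@in_strand R C).
Notation step := (step X (crit q) S G a).
Notation steps := (steps X (crit q) S G a).
Notation flow_rel := (flow_rel X (crit q) S G a).
Notation T := (@tame R).
Let HT := is_structure_tame R.
Let H := chain_strand_system chain_C space_C.

Definition chain_flow := flow X (crit q) S G a.

Lemma finite_crit : finite_set (crit q).
Proof.
suff -> : crit q = \bigcup_(i in [set i | (i <= n)%N]) [set q (Base x) | x in Lset i].
  apply: bigcup_finite; first exact: (finite_set_leP _).2 (ex_intro _ n.+1 _).
  move=> i ni; apply: finite_image.
  by case: chain_C => _ _ /(_ i ni) [[_ _ _ [f _ _] _] _ _ _].
apply/seteqP; split=> x.
  by case=> i [z [ni Lz ->]]; exists i => //; exists z.
by case=> i ni [z Lz <-]; exists i, z.
Qed.

Definition rho_piece i :=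
  piece (Yset i.+1) (fun y h => q (RhoP i.+1 y h)) (@rho R C i.+1) (@wplus R C i.+1).
Definition lam_piece i :=
  piece (Yset i.+1) (fun y h => q (LamP i y h)) (@lam R C i) (@wminus R C i).

Lemma slide_rho t x x' : slide S G a true t x x' <-> exists2 i, (i < n)%N & rho_piece i t x x'.
Proof.
split=> [[[i y] [h [h' [[/= lt Yy] hb hb' [e e' c]]]]]|[i lt [y [h [h' [Yy hb hb' [e e' c]]]]]]].
  by exists i => //; exists y, h, h'.
by exists (existT _ i y), h, h'.
Qed.

Lemma slide_lam t x x' : slide S G a false t x x' <-> exists2 i, (i < n)%N & lam_piece i t x x'.
Proof.
split=> [[[i y] [h [h' [[/= lt Yy] hb hb' [e e' c]]]]]|[i lt [y [h [h' [Yy hb hb' [e e' c]]]]]]].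
  by exists i => //; exists y, h, h'.
by exists (existT _ i y), h, h'.
Qed.

Lemma space_rho i : (i <= n)%N -> tame_cont (cyl (Yset i)) X
  (fun z => q (RhoP i (lsubmx z) (rsubmx z ord0 ord0))).
Proof. by case: space_C => _ _ h /h []. Qed.

Lemma space_lam i : (i <= n)%N -> tame_cont (cyl (Yset i.+1)) X
  (fun z => q (LamP i (lsubmx z) (rsubmx z ord0 ord0))).
Proof. by case: space_C => _ _ h /h []. Qed.

Lemma space_base i : (i <= n)%N -> tame_cont (Xset i) X (fun x => q (Base x)).
Proof. by case: space_C => _ _ h /h []. Qed.

Lemma blowdown_rho i : (i <= n)%N -> blowdown (Yset i) (Xset i) (@rho R C i) (Lset i).
Proof. by case: chain_C => _ _ h /h []. Qed.

Lemma blowdown_lam i : (i <= n)%N -> blowdown (Yset i.+1) (Xset i) (@lam R C i) (Lset i).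
Proof. by case: chain_C => _ _ h /h []. Qed.

Lemma weight_plus i : (i <= n)%N -> weight (Xset i) (Lset i) (@wplus R C i).
Proof. by case: chain_C => _ _ h /h []. Qed.

Lemma weight_minus i : (i <= n)%N -> weight (Xset i) (Lset i) (@wminus R C i).
Proof. by case: chain_C => _ _ h /h []. Qed.

(** Finitely many compact pieces: rests of duration [0], rests of duration at most [M] at the
    finitely many critical points, and one relation per cylinder. On the [lam] side the relation is
    swapped, as heights rise there. *)
Lemma compact_step M : compact [set p : R * ('rV[R]_N * 'rV[R]_N) |
  step p.1 p.2.1 p.2.2 /\ p.1 <= M].
Proof.
pose K1 := [set ((0 : R), (x, x)) | x in X].
have cK1 : compact K1.
  apply: continuous_compact compact_X; apply: within_pair; first exact: within_cst.
  by apply: within_pair; exact: within_id.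
pose K2 := [set (z.1, (z.2, z.2)) | z in `[(0 : R), M] `*` crit q].
have cK2 : compact K2.
  apply: continuous_compact; last first.
    by apply: compact_setX; [exact: segment_compact|exact: finite_compact finite_crit].
  apply: continuous_subspaceT.
  have p1 : continuous (fun z : R * 'rV[R]_N => z.1) by exact: continuous_fst.
  have p2 : continuous (fun z : R * 'rV[R]_N => z.2) by exact: continuous_snd.
  exact: (continuous_pair p1 (continuous_pair p2 p2)).
pose Kr i := [set p : R * ('rV[R]_N * 'rV[R]_N) | 0 <= p.1 <= M /\ rho_piece i p.1 p.2.1 p.2.2].
have cKr i : (i < n)%N -> compact (Kr i).
  move=> lt; have [[cY _] _ [rX cr _] _ _] := blowdown_rho lt.
  have [_ cG _] := space_rho lt; have [[cw _] _ _] := weight_plus lt.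
  exact: compact_piece cY cG cr cw.
pose Kl i := [set p : R * ('rV[R]_N * 'rV[R]_N) | 0 <= p.1 <= M /\ lam_piece i p.1 p.2.1 p.2.2].
have cKl i : (i < n)%N -> compact (Kl i).
  move=> lt; have [[cY _] _ [rX cr _] _ _] := blowdown_lam (ltnW lt).
  have [_ cG _] := space_lam (ltnW lt); have [[cw _] _ _] := weight_minus (ltnW lt).
  exact: compact_piece cY cG cr cw.
have := compactU (compactU cK1 cK2)
  (compactU (compact_bigUn cKr) (compact_swap (compact_bigUn cKl))).
move/(@compact_time_le _ _ _ M); congr compact; apply/seteqP; split=> -[t [x x']] /=.
  case=> h tM; split=> //; case: h => [[[z Xz [<- <- <-]]|[[s z] /= [sM cz] [<- <- <-]]]|].
  - exact: step_refl.
  - have Xz := crit_sub H cz; split=> //; last by apply: Or42.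
    by move: sM; rewrite in_itv /= => /andP[].
  - case=> -[i lt [/= /andP[t0 _] p]].
      have mv : slide S G a true t x x' by apply/slide_rho; exists i.
      by have [Xx Xx'] := slide_X H mv; split=> //; apply: Or43.
    have mv : slide S G a false t x' x by apply/slide_lam; exists i.
    by have [Xx' Xx] := slide_X H mv; split=> //; apply: Or44.
case=> -[t0 Xx Xx' h] tM; split=> //.
have tb : 0 <= t <= M by rewrite t0.
case: h => [[-> <-]|[cx <-]|/slide_rho[i lt p]|/slide_lam[i lt p]].
- by left; left; exists x.
- by left; right; exists (t, x) => //=; rewrite in_itv.
- by right; left; exists i.
- by right; right; exists i.
Qed.

(** Times are nonnegative, so a total time at most [M] bounds both summands by [M], and composition
    stays among compact relations. *)
Lemma compact_steps m M : compact [set p : R * ('rV[R]_N * 'rV[R]_N) |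
  steps m p.1 p.2.1 p.2.2 /\ p.1 <= M].
Proof.
elim: m => [|m IH].
  have c : compact [set ((0 : R), (x, x)) | x in X].
    apply: continuous_compact compact_X; apply: within_pair; first exact: within_cst.
    by apply: within_pair; exact: within_id.
  have := compact_time_le (M := M) c; congr compact; apply/seteqP; split=> -[t [x x']] /=.
    by case=> -[z Xz [<- <- <-]].
  by case=> -[-> Xx <-] M0; split=> //; exists x.
have := compact_time_le (M := M) (compact_compose (@compact_step M) IH).
congr compact; apply/seteqP; split=> -[t [x x']] /=.
  by case=> -[s [r [y [[ss _] [sr _] ->]]]] tM; split=> //; exists s, r, y.
case=> -[s [r [y [ss sr ->]]]] tM; split=> //; exists s, r, y; split=> //; split=> //.
  by have := steps_ge0 sr; lra.
by have [s0 _ _ _] := ss; lra.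
Qed.

Lemma flow_relE t x z : flow_rel t x z <->
  (0 <= t /\ steps (nsteps n) t x z) \/ (t <= 0 /\ steps (nsteps n) (- t) z x).
Proof.
split=> -[[t0 h]|[t0 h]]; [left|right|left|right]; split=> //;
  by [exact: (reach_steps H)|exists (nsteps n)].
Qed.

Lemma compact_flow_rel M : compact [set p : R * ('rV[R]_N * 'rV[R]_N) |
  flow_rel p.1 p.2.1 p.2.2 /\ - M <= p.1 <= M].
Proof.
have c1 := @compact_steps (nsteps n) M.
have := compactU c1 (compact_opp_time (compact_swap c1)).
congr compact; apply/seteqP; split=> -[t [x z]] /=.
  case=> -[st tM]; have t0 := steps_ge0 st; split; try lra.
    by apply/flow_relE; left.
  by apply/flow_relE; right; split=> //; lra.
case=> /flow_relE[] [t0 st] /andP[Mt tM]; [left|right]; split=> //; lra.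
Qed.

Lemma dfn_step k (g : 'rV[R]_k -> R) (u v : 'rV[R]_k -> 'rV[R]_N) :
  polyfun g -> polymap u -> polymap v -> dfn T (fun z => step (g z) (u z) (v z)).
Proof.
move=> hg hu hv.
apply: (@dfn_iff _ T _ (fun z => [/\ 0 <= g z, X (u z) & X (v z)] /\
   (g z = 0 /\ u z = v z \/ (crit q (u z) /\ u z = v z \/
   ((exists2 i, (i < n)%N & rho_piece i (g z) (u z) (v z)) \/
    (exists2 i, (i < n)%N & lam_piece i (g z) (v z) (u z))))))).
  move=> z; split.
    case=> -[g0 Xu Xv] h; split=> //.
    case: h => [?|[?|[/slide_rho|/slide_lam]]];
      [exact: Or41|exact: Or42|exact: Or43|exact: Or44].
  case=> g0 Xu Xv h; split=> //; case: h => [?|?|/slide_rho ?|/slide_lam ?];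
    [by left|by right; left|by right; right; left|by right; right; right].
have dX (w : 'rV[R]_k -> 'rV[R]_N) : polymap w -> dfn T (fun z => X (w z)).
  by move=> hw; apply: (dfn_pre HT tame_X).
apply: (dfn_and HT).
  by apply: (dfn_and3 HT); [apply: (dfn_ge0 HT)|exact: dX|exact: dX].
apply: (dfn_or HT).
  by apply: (dfn_and HT); [apply: (dfn_eq0 HT)|apply: (dfn_eqv HT)].
apply: (dfn_or HT).
  apply: (dfn_and HT); last exact: (dfn_eqv HT).
  exact: (dfn_pre HT (dfn_finite HT finite_crit)).
apply: (dfn_or HT); apply: (dfn_exn HT) => i lt.
  have [_ _ [rX _ tr] _ _] := blowdown_rho lt.
  have [_ _ tG] := space_rho lt; have [[_ tw] _ _] := weight_plus lt.
  exact: (dfn_piece (G := fun y h => q (RhoP i.+1 y h)) rX HT tG tr tw).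
have [_ _ [rX _ tr] _ _] := blowdown_lam (ltnW lt).
have [_ _ tG] := space_lam (ltnW lt); have [[_ tw] _ _] := weight_minus (ltnW lt).
exact: (dfn_piece (G := fun y h => q (LamP i y h)) rX HT tG tr tw).
Qed.

Lemma dfn_steps m k (g : 'rV[R]_k -> R) (u v : 'rV[R]_k -> 'rV[R]_N) :
  polyfun g -> polymap u -> polymap v -> dfn T (fun z => steps m (g z) (u z) (v z)).
Proof.
elim: m k g u v => [|m IH] k g u v hg hu hv /=.
  apply: (dfn_and3 HT); [exact: (dfn_eq0 HT)| |exact: (dfn_eqv HT)].
  exact: (dfn_pre HT tame_X).
apply: (dfn_exR HT); apply: (dfn_exR HT); apply: (dfn_ex HT).
apply: (dfn_and3 HT); [apply: dfn_step; polyt|apply: IH; polyt|apply: (dfn_eq HT); polyt].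
Qed.

Lemma dfn_flow_rel k (g : 'rV[R]_k -> R) (u v : 'rV[R]_k -> 'rV[R]_N) :
  polyfun g -> polymap u -> polymap v -> dfn T (fun z => flow_rel (g z) (u z) (v z)).
Proof.
move=> hg hu hv; apply: (@dfn_iff _ T _ (fun z => (0 <= g z /\ steps (nsteps n) (g z) (u z) (v z)) \/
    (g z <= 0 /\ steps (nsteps n) (- g z) (v z) (u z)))) => [z|].
  exact: iff_sym (flow_relE _ _ _).
apply: (dfn_or HT); apply: (dfn_and HT).
- exact: (dfn_ge0 HT).
- exact: dfn_steps.
- by apply: (dfn_le HT); polyt.
- by apply: dfn_steps; polyt.
Qed.

Lemma chain_flow_tame_cont : tame_cont (prod_set [set: 'rV[R]_1] X) X
  (fun z => chain_flow (lsubmx z ord0 ord0) (rsubmx z)).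
Proof.
split.
- by move=> z [_ Xz]; exact: (flow_X H).
- apply: continuous_of_compact_graph => [|z [_ Xz]].
    exact: norm_hausdorff.
  (* The window [[- M, M]] is a neighbourhood of the time coordinate of [z]; over it the graph of
     the flow is the compact relation with its coordinates rearranged. *)
  pose M : R := `|lsubmx z ord0 ord0| + 1.
  exists [set w : 'rV_(1 + N) | - M <= lsubmx w ord0 ord0 <= M].
    have cl : continuous (fun w : 'rV[R]_(1 + N) => lsubmx w ord0 ord0).
      exact: continuous_compose (@continuous_coord R 1 ord0) (@continuous_lsubmx R 1 N).
    have h : nbhs (lsubmx z ord0 ord0 : R) `]- M, M[%classic.
      by apply: near_in_itvoo; rewrite in_itv /= -ltr_norml /M; lra.
    have h2 : nbhs z ((fun w : 'rV[R]_(1 + N) => lsubmx w ord0 ord0) @^-1` `]- M, M[%classic).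
      exact: (cl z _ h).
    by apply: (filterS _ h2) => w /=; rewrite in_itv /= => /andP[/ltW -> /ltW ->].
  have cf : continuous (fun p : R * ('rV[R]_N * 'rV[R]_N) =>
      (row_mx (const_mx p.1 : 'rV_1) p.2.1, p.2.2)).
    have p1 : continuous (fun z : R * ('rV[R]_N * 'rV[R]_N) => z.1) by exact: continuous_fst.
    have p2 : continuous (fun z : R * ('rV[R]_N * 'rV[R]_N) => z.2) by exact: continuous_snd.
    have c3 := continuous_compose (@continuous_const_mx R) p1.
    have c4 := continuous_pair c3 (continuous_proj1 p2).
    have c5 := continuous_compose (@continuous_row_mx R 1 N) c4.
    exact: (continuous_pair c5 (continuous_proj2 p2)).
  have := continuous_compact (continuous_subspaceT cf) (@compact_flow_rel M).
  congr compact; apply/seteqP; split=> -[w x'] /=.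
    case=> -[t [x y]] /= [fr tM] [<- <-]; exists (row_mx (const_mx t) x).
      rewrite /prod_set /= row_mxKl row_mxKr mxE; split=> //; split=> //.
      by have [] := flow_rel_X fr.
    rewrite row_mxKl row_mxKr mxE; congr pair; apply/(flowP H) => //.
    by have [] := flow_rel_X fr.
  case=> v [[_ Xv] vM] [<- <-].
  exists (lsubmx v ord0 ord0, (rsubmx v, chain_flow (lsubmx v ord0 ord0) (rsubmx v))) => //=.
    by split=> //; apply/(flowP H).
  congr pair; rewrite -[RHS]hsubmxK; congr row_mx.
  by apply/rowP => j; rewrite [LHS]mxE (ord1 j).
- apply: (@graph_dfn _ T); apply: (@dfn_iff _ T _ (fun z : 'rV_(1 + N + N) =>
    X (rsubmx (lsubmx z)) /\
    flow_rel (lsubmx (lsubmx z) ord0 ord0) (rsubmx (lsubmx z)) (rsubmx z))).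
    move=> z; split=> [[Xz fr]|[[_ Xz] e]]; split=> //; by [apply/esym/(flowP H)|apply/(flowP H)].
  apply: (dfn_and HT); first by apply: (dfn_pre HT tame_X); polyt.
  by apply: dfn_flow_rel; polyt.
Qed.

Lemma level_tame_cont : tame_cont1 X (level q).
Proof.
pose Kc := [set (x, level q x) | x in crit q].
pose val b i (h : R) : R := i%:R + (if b then 1 + h else 1 - h) / 2.
pose Kr i := [set (q (RhoP i.+1 z.1 z.2), val true i z.2) |
  z in [set z : 'rV[R]_(ydim C i.+1) * R | Yset i.+1 z.1 /\ 0 <= z.2 <= 1]].
pose Kl i := [set (q (LamP i z.1 z.2), val false i z.2) |
  z in [set z : 'rV[R]_(ydim C i.+1) * R | Yset i.+1 z.1 /\ 0 <= z.2 <= 1]].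
(* The graph is cut into a finite critical part and one continuous image of a compact product per
   cylinder. *)
have E : [set (x, level q x) | x in X] = Kc `|`
    ([set p | exists2 i, (i < n)%N & Kr i p] `|` [set p | exists2 i, (i < n)%N & Kl i p]).
  apply/seteqP; split=> p.
    case=> x Xx <-; case: (strand_cover H Xx) => [cx|[b [[i y] [h [Sy hb ->]]]]].
      by left; exists x.
    rewrite (level_strand space_C)//; case: Sy => /= lt Yy.
    by right; case: b; [left|right]; exists i => //; exists (y, h).
  case=> [[x cx <-]|[|] [i lt [[y h] [/= Yy hb] <-]]].
  - by exists x => //; exact: (crit_sub H).
  - have Sy : S (existT _ i y) by [].
    exists (G true (existT _ i y) h); first exact: (strand_sub H).
    by rewrite (level_strand space_C).
  - have Sy : S (existT _ i y) by [].
    exists (G false (existT _ i y) h); first exact: (strand_sub H).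
    by rewrite (level_strand space_C).
split.
  apply: continuous_of_compact_graph1; first exact: norm_hausdorff.
  rewrite E; apply: compactU; first exact/finite_compact/finite_image/finite_crit.
  have cp (i : nat) : compact (Yset i.+1) ->
      compact [set z : 'rV[R]_(ydim C i.+1) * R | Yset i.+1 z.1 /\ 0 <= z.2 <= 1].
    move=> cY; have := compact_setX cY (@segment_compact R 0 1).
    congr compact; apply/seteqP; split=> z /=; rewrite in_itv /=; by [case|].
  have cv b i (A : set ('rV[R]_(ydim C i.+1) * R)) : {within A, continuous (fun z => val b i z.2)}.
    have c2 : {within A, continuous (fun z => z.2)} by exact/continuous_subspaceT/continuous_snd.
    apply: within_add; first exact: within_cst.
    apply: within_mul; last exact: within_cst.
    case: b; apply: within_add => //; first exact: within_cst.
      exact: within_cst.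
    exact: within_opp.
  apply: compactU; apply: compact_bigUn => i lt.
    have [[cY _] _ _ _ _] := blowdown_rho lt; have [_ cG _] := space_rho lt.
    apply: continuous_compact (cp _ cY); apply: within_pair; last exact: cv.
    exact: (within_strand (G := fun y h => q (RhoP i.+1 y h)) cG).
  have [[cY _] _ _ _ _] := blowdown_rho lt; have [_ cG _] := space_lam (ltnW lt).
  apply: continuous_compact (cp _ cY); apply: within_pair; last exact: cv.
  exact: (within_strand (G := fun y h => q (LamP i y h)) cG).
apply: (@graph1_dfn _ T).
pose D b i (z : 'rV[R]_(N + 1)) := exists (y : 'rV[R]_(ydim C i.+1)) h,
  ((Yset i.+1 y /\ 0 <= h <= 1) /\
   lsubmx z = (if b then q (RhoP i.+1 y h) else q (LamP i y h))) /\
  rsubmx z ord0 ord0 = val b i h.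
pose Dc (z : 'rV[R]_(N + 1)) := exists2 i, (i < n.+1)%N &
  exists x : 'rV[R]_(xdim C i), (Xset i x /\ lsubmx z = q (Base x)) /\ rsubmx z ord0 ord0 = i%:R.
apply: (@dfn_iff _ T _ (fun z => Dc z \/ ((exists2 i, (i < n)%N & D true i z) \/
    (exists2 i, (i < n)%N & D false i z)))).
  move=> z; split.
    case=> [[i ni [x [[Xx ->] ->]]]|[|] [i lt [y [h [[[Yy hb] ->] ->]]]]].
    - have dx : glue_dom (Base x) by [].
      by split; [exact: (q_X space_C)|rewrite (level_q space_C)].
    - have Sy : S (existT _ i y) by [].
      split; first exact: (strand_sub H true Sy hb).
      by have := level_strand space_C true Sy hb.
    - have Sy : S (existT _ i y) by [].
      split; first exact: (strand_sub H false Sy hb).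
      by have := level_strand space_C false Sy hb.
  case=> Xz ez; case: (strand_cover H Xz) => [[i [x [ni Lx e]]]|[b [[i y] [h [Sy hb e]]]]].
    have Xx := loc_X chain_C ni Lx.
    by left; exists i => //; exists x; split=> //; rewrite ez e (level_q space_C).
  have := level_strand space_C b Sy hb; rewrite -e -ez.
  case: Sy => /= lt Yy ev.
  by right; case: b e ev => e ev; [left|right]; exists i => //; exists y, h.
apply: (dfn_or HT).
  apply: (dfn_exn HT) => i ni; apply: (dfn_ex HT); apply: (dfn_and HT).
    have [_ _ tg] := space_base ni.
    by apply: (dfn_graph HT tg); polyt.
  by apply: (dfn_eq HT); polyt.
have dv b i m (u : 'rV[R]_m -> R) : polyfun u -> polyfun (fun z => val b i (u z)).
  by move=> hu; case: b; rewrite /val; polyt.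
apply: (dfn_or HT); apply: (dfn_exn HT) => i lt; apply: (dfn_ex HT); apply: (dfn_exR HT);
  apply: (dfn_and HT).
- have [_ _ tg] := space_rho lt.
  by apply: (dfn_strand (G := fun y h => q (RhoP i.+1 y h)) HT tg); polyt.
- by apply: (dfn_eq HT); [polyt|apply: dv; polyt].
- have [_ _ tg] := space_lam (ltnW lt).
  by apply: (dfn_strand (G := fun y h => q (LamP i y h)) HT tg); polyt.
- by apply: (dfn_eq HT); [polyt|apply: dv; polyt].
Qed.

End ChainFlow.

(** * The chain of the flow *)

(** All subsets of [F] are closed, so [x] is relatively open and closed in [A]. Serves the constancy
    of the Lyapunov function along paths of stationary points. *)
Lemma connected_finite (T : topologicalType) (A F : set T) x y : hausdorff_space T ->
  connected A -> finite_set F -> A `<=` F -> A x -> A y -> x = y.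
Proof.
move=> hT cA fF AF Ax Ay.
have cl (B : set T) : B `<=` F -> closed B.
  by move=> BF; apply: compact_closed => //; apply: finite_compact; exact: (sub_finite_set BF fF).
have e : A `&` [set x] = A.
  apply: cA; first by exists x.
    exists (~` (F `\` [set x])); first by apply: closed_openC; apply: cl => ? [].
    apply/seteqP; split=> z [Az h]; split=> //.
      by rewrite h => -[_]; apply.
    by apply: contrapT => nz; apply: h; split=> //; exact: AF.
  by exists [set x] => //; apply: cl => _ ->; exact: AF.
by have : (A `&` [set x]) y; [rewrite e|case=> _ ->].
Qed.

Lemma tame_homeo_compact (R : realType) n m (A : set 'rV[R]_n) (B : set 'rV[R]_m)
    (h : 'rV[R]_n -> 'rV[R]_m) :
  compact A -> tame_cont A B h -> {in A &, injective h} ->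
  (forall x, B x -> exists2 y, A y & h y = x) -> tame_homeo A B h.
Proof.
move=> cA tc inj sur; have [AB ch _] := tc.
pose g x := xget 0 [set y | A y /\ h y = x].
have gK x : A x -> g (h x) = x.
  move=> Ax; apply: xget_unique => // y [Ay e]; apply: inj => //; exact: mem_set.
split=> //; split=> //; exists g => //.
apply: (within_inverse _ cA ch gK); first exact: norm_hausdorff.
by apply/seteqP; split=> [_ [x Ax <-]|x /sur[y Ay <-]]; [exact: AB|exists y].
Qed.

Lemma ereal_sup_itv0 (R : realType) (T : R) (P : R -> Prop) : 0 < T ->
  (forall t, P t <-> 0 < t /\ t <= T) -> ereal_sup [set t%:E | t in [set t | P t]] = T%:E.
Proof.
move=> T0 h; apply/eqP; rewrite eq_le; apply/andP; split.
  by apply: ge_ereal_sup => _ [t /h[_ tT] <-]; rewrite lee_fin.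
by apply: ereal_sup_ubound; exists T => //; apply/h.
Qed.

Lemma ereal_sup_pos (R : realType) (P : R -> Prop) :
  (forall t, 0 < t -> P t) -> ereal_sup [set t%:E | t in [set t | P t]] = +oo%E.
Proof.
move=> h; apply: hasNub_ereal_sup.
  move=> [M hM]; have := hM (`|M| + 1); have := ler_norm M => l1 l2.
  by have := l2 (h _ _); have := normr_ge0 M => l3; move=> /(_ ltac:(lra)); lra.
by exists 1; apply: h; rewrite ltr01.
Qed.

Lemma natr_eq (R : realType) (i j : nat) (r : R) : -1 < r < 1 -> i%:R = j%:R + r -> i = j /\ r = 0.
Proof.
move=> /andP[r0 r1] e.
have l1 : (i%:R : R) < j.+1%:R by rewrite e -natr1; lra.
have l2 : (j%:R : R) < i.+1%:R by rewrite -natr1 e; lra.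
rewrite !ltr_nat !ltnS in l1 l2.
have ij : i = j by apply/eqP; rewrite eqn_leq l1.
by split=> //; rewrite ij in e; lra.
Qed.

Section Final.
Variables (R : realType) (N : nat) (X : set 'rV[R]_N) (C : chain R).
Hypothesis chain_C : weighted_chain C.
Variable q : glue_point C -> 'rV[R]_N.
Hypothesis space_C : associated_space X q.
Hypothesis compact_X : compact X.
Hypothesis tame_X : tame X.
Notation n := (len C).
Notation Yset i := (@Ysp R C i).
Notation Xset i := (@Xsp R C i).
Notation Lset i := (@loc R C i).
Notation RhoP i := (@CylRho R C i).
Notation LamP i := (@CylLam R C i).
Notation G := (strand_pt q).
Notation a := (@strand_weight R C).
Notation S := (@in_strand R C).
Notation Phi := (chain_flow X q).
Notation f := (level q).
Notation c := (fun i : nat => i%:R : R).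
Let H := chain_strand_system chain_C space_C.

Lemma level_mono b y h h' : S y -> 0 <= h <= 1 -> 0 <= h' <= 1 -> h' < h ->
  if b then f (G b y h') < f (G b y h) else f (G b y h) < f (G b y h').
Proof. by move=> Sy hb hb' hh; rewrite !(level_strand space_C)//; case: b; lra. Qed.

Lemma level_decreasing x s t : X x -> ~ crit q x -> s < t -> f (Phi t x) < f (Phi s x).
Proof. by apply: (flow_decreasing H) => b y h h'; exact: level_mono. Qed.

Lemma Cr_chain_flow : Cr X Phi = crit q.
Proof.
apply/seteqP; split=> x.
  case=> Xx fx; apply: contrapT => nc.
  by have := level_decreasing Xx nc ltr01; rewrite !fx ltxx.
by move=> cx; split; [exact: (crit_sub H)|move=> t; exact: (flow_crit H)].
Qed.

Lemma chain_flow_lyapunov : lyapunov X Phi f.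
Proof.
split; first exact: (level_tame_cont chain_C space_C).
  move=> x Xx [t0 ne] s t st; apply: level_decreasing => // cx; apply: ne.
  exact: (flow_crit H).
move=> gam cg; rewrite Cr_chain_flow => hg; congr f.
apply: (@connected_finite _ (gam @` `[0, 1]) (crit q)).
- exact: norm_hausdorff.
- by apply: connected_continuous_connected => //; exact: segment_connected.
- exact: (finite_crit chain_C).
- by move=> x [t]; rewrite /= in_itv /= => ht <-; exact: hg.
- by exists 0 => //; rewrite /= in_itv /= lexx ler01.
- by exists 1 => //; rewrite /= in_itv /= lexx ler01.
Qed.

Lemma chain_flow_Fl_grad : Fl_grad X Phi.
Proof.
split.
- split; first exact: (chain_flow_tame_cont chain_C space_C compact_X tame_X).
    by move=> x Xx; exact: (flow0 H).
  by move=> s t x Xx; exact: (flowD H).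
- by exists f; exact: chain_flow_lyapunov.
- by rewrite Cr_chain_flow; exact: (finite_crit chain_C).
Qed.

Lemma chain_flow_levels : critical_levels X Phi f n c.
Proof.
split=> [i j /andP[ij _]|]; first by rewrite ltr_nat.
rewrite Cr_chain_flow; apply/seteqP; split=> x.
  by case=> z /(crit_level chain_C space_C)[i ni e] <-; rewrite e; exists i.
case=> i /= ni <-.
have [_ _ _ [_ [z Lz] _] _] := blowdown_rho chain_C ni.
exists (q (Base z)); first by exists i, z.
by rewrite (level_q space_C)//; split=> //; exact: (loc_X chain_C).
Qed.

Lemma level_Base i (x : 'rV_(xdim C i)) : (i <= n)%N -> Xset i x -> f (q (Base x)) = i%:R.
Proof. by move=> ni Xx; rewrite (level_q space_C). Qed.

Lemma X_Base i (x : 'rV_(xdim C i)) : (i <= n)%N -> Xset i x -> X (q (Base x)).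
Proof. by move=> ni Xx; apply: (q_X space_C). Qed.

(** Along a strand the level runs between [tag y] and [tag y + 1], so it is an integer only at the
    two ends, which are base points. *)
Lemma Xlevel_Base i x : (i <= n)%N -> Xlevel X f c i x ->
  exists2 z, Xset i z & q (Base z) = x.
Proof.
move=> ni [Xx]; case: (strand_cover H Xx) => [[j [z [nj Lz ->]]]|[b [[j y] [h [Sy hb e]]]]].
  have Xz := loc_X chain_C nj Lz; rewrite level_Base// => /eqP.
  by rewrite eqr_nat => /eqP ji; subst j; exists z.
have := level_strand space_C b Sy hb; rewrite -e => -> /= E.
have [/= lt Yy] := Sy; case: b e E => e E.
  have rg : -1 < (1 + h) / 2 - 1 < 1 by lra.
  have [ji r0] : i = j.+1 /\ (1 + h) / 2 - 1 = 0.
    by apply: natr_eq rg _; rewrite -E -natr1; ring.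
  have h1 : h = 1 by lra.
  move: e; rewrite h1 (strand_pt1 chain_C space_C)//= => e; subst i.
  by exists (rho y) => //; exact: (rho_X chain_C).
have rg : -1 < (1 - h) / 2 < 1 by lra.
have [ji r0] := natr_eq rg (esym E).
have h1 : h = 1 by lra.
move: e; rewrite h1 (strand_pt1 chain_C space_C)//= => e; subst i.
by exists (lam y) => //; apply: (lam_X chain_C) => //; exact: ltnW.
Qed.

Lemma homeo_X i : (i <= n)%N -> tame_homeo (Xset i) (Xlevel X f c i) (fun x => q (Base x)).
Proof.
move=> ni; have [_ [cX _] _ _ _] := blowdown_rho chain_C ni.
have [_ ct tg] := space_base space_C ni.
apply: tame_homeo_compact => //.
- by split=> // x Xx; split; [exact: X_Base|exact: level_Base].
- by move=> x x' /set_mem Xx /set_mem Xx'; exact: (q_Base_inj space_C).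
- by move=> x; exact: Xlevel_Base.
Qed.

Lemma dlevelE i : dlevel c i.+1 = i%:R + 1 / 2 :> R.
Proof. by rewrite /dlevel /= -natr1; field. Qed.

Lemma level_mid b y : S y -> f (G b y 0) = (tag y)%:R + 1 / 2.
Proof.
move=> Sy; rewrite (level_strand space_C)//; last by lra.
by case: b; rewrite ?addr0 ?subr0.
Qed.

(** A level halfway between two consecutive critical ones is met at height [0] only. At the two
    extreme indices both sides are empty. *)
Lemma homeo_Y i : (i <= n.+1)%N ->
  tame_homeo (Yset i) (Ylevel X f n c i) (fun y => q (RhoP i y 0)).
Proof.
move=> ni; rewrite /Ylevel.
have tame0 k : tame (set0 : set 'rV[R]_k) by exact: (dfn_false (is_structure_tame R)).
have empty : Yset i = set0 -> tame_homeo (Yset i) set0 (fun y => q (RhoP i y 0)).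
  move=> ->; apply: tame_homeo_compact => //; first exact: compact0.
    split=> //; first by apply/subspace_continuousP.
    by rewrite /graph image_set0; exact: tame0.
  by move=> x y; rewrite inE.
case: i ni empty => [|i] ni empty /=.
  by apply: empty; case: chain_C => _ [].
case: ltnP => lt; last first.
  apply: empty; have -> : i = n by apply/eqP; rewrite eqn_leq lt -ltnS ni.
  by case: chain_C => _ [].
have [[cY _] _ _ _ _] := blowdown_rho chain_C lt.
have [_ cG tG] := space_rho space_C lt.
have hb : 0 <= (0 : R) <= 1 by lra.
apply: tame_homeo_compact => //.
- split.
  + move=> y Yy; have Sy : S (existT _ i y) by [].
    split; first exact: (strand_sub H true Sy hb).
    by rewrite dlevelE; exact: (level_mid true Sy).
  + have := within_strand (G := fun y h => q (RhoP i.+1 y h)) cG => cG'.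
    apply: (within_comp (f := fun y => (y, 0)) cG') => //.
    by apply: within_pair; [exact: within_id|exact: within_cst].
  + apply: (@graph_dfn _ (@tame R)).
    have h := dfn_strand (G := fun y h => q (RhoP i.+1 y h)) (is_structure_tame R) tG
      (polymap_lsubmx (@polymap_id R (ydim C i.+1 + N))) (polyfun_cst _ 0)
      (polymap_rsubmx (@polymap_id R (ydim C i.+1 + N))).
    by apply: dfn_iff h => z; split=> [[[]]|[]].
- move=> y y' /set_mem Yy /set_mem Yy' e.
  have Sy : S (existT _ i y) by []. have Sy' : S (existT _ i y') by [].
  have [|E _] := strand_inj H (b := true) Sy Sy' hb hb _ e.
    by apply: (not_crit_lt1 H) => //; lra.
  exact: (existT_nat_inj E).
- move=> x [Xx]; rewrite dlevelE.
  case: (strand_cover H Xx) => [cx|[b [[j y] [h [Sy hh e]]]]].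
    have [j _ ->] := crit_level chain_C space_C cx => E.
    by case: (@natr_half R j i (1 / 2) _ E); lra.
  rewrite e (level_strand space_C)//= => E; have [/= ltj Yy] := Sy.
  have rg : -1 < (if b then h else - h) / 2 < 1 by case: b {e E}; lra.
  have [ij r0] : i = j /\ (if b then h else - h) / 2 = 0.
    by apply: natr_eq rg _; case: b {e} E; lra.
  have h0 : h = 0 by case: b {rg e E} r0; lra.
  have E0 : x = G true (existT _ j y) 0.
    by rewrite e h0; case: b {rg e E r0} => //; rewrite (strand_mid H).
  by subst j; exists y => //; rewrite -e E0.
Qed.

Lemma loc_image i : (i <= n)%N ->
  [set q (Base x) | x in Lset i] = Cr X Phi `&` Xlevel X f c i.
Proof.
move=> ni; rewrite Cr_chain_flow; apply/seteqP; split=> x.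
  case=> z Lz <-; have Xz := loc_X chain_C ni Lz.
  split; first by exists i, z.
  by split; [exact: X_Base|exact: level_Base].
case=> cx /(Xlevel_Base ni)[z Xz e]; exists z => //.
by apply/(crit_Base chain_C space_C ni Xz); rewrite e.
Qed.

(** Treats both halves alike: going from the middle to the end takes time of sign [- orient b], and
    [orient b * f] increases on the way. *)
Definition orient (b : bool) : R := if b then 1 else - 1.

Lemma orientK b t : orient b * (orient b * t) = t.
Proof. by rewrite /orient; case: b; ring. Qed.

Lemma flow_along b y h : S y -> 0 <= h <= 1 -> ~ crit q (G b y h) ->
  Phi (- (orient b * ctime (a b y) h)) (G b y 0) = G b y h.
Proof.
move=> Sy /andP[h0 h1] nc; case: b nc => nc; rewrite /orient.
  have := flow_stepN H (step_up H Sy (lexx 0) h0 h1 nc).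
  by rewrite ctime0 subr0 mul1r.
have := flow_step H (step_down H Sy (lexx 0) h0 h1 nc).
by rewrite ctime0 subr0 mulN1r opprK.
Qed.

Lemma flow_back b y h : S y -> 0 <= h <= 1 -> ~ crit q (G b y h) ->
  Phi (orient b * ctime (a b y) h) (G b y h) = G b y 0.
Proof.
move=> Sy hb nc; rewrite -[X in Phi _ X](flow_along Sy hb nc) /chain_flow -(flowD H); last first.
  by apply: (strand_sub H) => //; lra.
by rewrite subrr (flow0 H)//; apply: (strand_sub H) => //; lra.
Qed.

Lemma oriented_level_mono b x s t : X x -> ~ crit q x -> s < t ->
  orient b * f (Phi (- (orient b * s)) x) < orient b * f (Phi (- (orient b * t)) x).
Proof.
move=> Xx nc st; rewrite /orient; case: b.
  by rewrite !mul1r; apply: level_decreasing => //; lra.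
by rewrite !mulN1r ltrN2 !opprK; apply: level_decreasing.
Qed.

Lemma oriented_level b y h : S y -> 0 <= h <= 1 ->
  orient b * f (G b y h) = orient b * ((tag y)%:R + 1 / 2) + h / 2.
Proof.
by move=> Sy hb; rewrite (level_strand space_C)// /orient; case: b; lra.
Qed.

Lemma continuous_strand b y : S y -> {within `[0, 1], continuous (G b y)}.
Proof.
case: y => j y [/= lt Yy]; case: b.
  have [_ cG _] := space_rho space_C lt.
  apply: (within_comp (f := fun h => (y, h))
    (within_strand (G := fun z h => q (RhoP j.+1 z h)) cG)).
    by apply: within_pair; [exact: within_cst|exact: within_id].
  by move=> h /=; rewrite in_itv.
have [_ cG _] := space_lam space_C (ltnW lt).
apply: (within_comp (f := fun h => (y, h))
  (within_strand (G := fun z h => q (LamP j z h)) cG)).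
  by apply: within_pair; [exact: within_cst|exact: within_id].
by move=> h /=; rewrite in_itv.
Qed.

Definition end_index (b : bool) (y : strand C) : nat := if b then (tag y).+1 else tag y.

Lemma level_end b y : S y -> f (G b y 1) = (end_index b y)%:R.
Proof.
move=> Sy; rewrite (level_strand space_C)//; last by lra.
by rewrite /end_index; case: b; last rewrite subrr mul0r addr0//;
  rewrite -[in RHS]natr1; field.
Qed.

Lemma strand_X b y h : S y -> 0 <= h <= 1 -> X (G b y h).
Proof. exact: (strand_sub H). Qed.

(** The end lies on the orbit, and strict decrease of [f] along the orbit leaves no second point at
    that level. *)
Lemma level_proj_finite b y : S y -> ~ crit q (G b y 1) ->
  level_proj X Phi f c (end_index b y) (G b y 0) = G b y 1.
Proof.
move=> Sy nc; have hb : 0 <= (1 : R) <= 1 by lra. have hb0 : 0 <= (0 : R) <= 1 by lra.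
have Xy := strand_X b Sy hb0.
have ncy : ~ crit q (G b y 0) by apply: (not_crit_lt1 H) => //; lra.
have orb : Defs.orbit Phi (G b y 0) (G b y 1).
  by exists (- (orient b * ctime (a b y) 1)) => //; exact: flow_along.
have lev : Xlevel X f c (end_index b y) (G b y 1).
  by split; [exact: strand_X|exact: level_end].
apply: xget_unique; first by split=> //; left.
move=> x [[Xx fx]] [[t _ e]|[e _]]; last first.
  have both : (Defs.orbit Phi (G b y 0) `&` Xlevel X f c (end_index b y)) (G b y 1) by split.
  by rewrite e in both.
case: orb => s _ e'; rewrite -e -e'.
have : f (Phi t (G b y 0)) = f (Phi s (G b y 0)) by rewrite e e' fx level_end.
by case: (ltgtP s t) => [l|l|->//]; have := level_decreasing Xy ncy l => l2 E;
  rewrite E ltxx in l2.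
Qed.

(** The weight is [0], so the end is approached but never reached. No other limit point has its
    level, because the orbit stays in a closed set that meets this level in the end only. *)
Lemma level_proj_limit b y : S y -> crit q (G b y 1) ->
  level_proj X Phi f c (end_index b y) (G b y 0) = G b y 1.
Proof.
move=> Sy cy; have hb : 0 <= (1 : R) <= 1 by lra. have hb0 : 0 <= (0 : R) <= 1 by lra.
have a0 : a b y = 0 by have [_] := (crit_strand H b Sy hb).1 cy.
have Xy := strand_X b Sy hb0.
have ncy : ~ crit q (G b y 0) by apply: (not_crit_lt1 H) => //; lra.
have lev : Xlevel X f c (end_index b y) (G b y 1).
  by split; [exact: strand_X|exact: level_end].
(* On one side of time [0] the orbit follows the half-strand forever, at heights below [1]; on the
   other side monotonicity keeps it beyond the middle level. *)
have along t : Phi t (G b y 0) = G b y 0 \/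
    orient b * f (Phi t (G b y 0)) <= orient b * f (G b y 0) \/
    exists2 h, 0 <= h < 1 & Phi t (G b y 0) = G b y h.
  have et : t = - (orient b * - (orient b * t)) by rewrite mulrN orientK opprK.
  move: (- (orient b * t)) et => s ->.
  have [s0|s0|->] := ltgtP s 0; last by left; rewrite mulr0 oppr0 /chain_flow (flow0 H).
    right; left; have := oriented_level_mono b Xy ncy s0.
    by rewrite mulr0 oppr0 /chain_flow (flow0 H)// => /ltW.
  right; right.
  have p : 0 < 1 + a b y - 0 by rewrite a0; lra.
  have [h [/andP[h0 h1] hp e]] := ctime_solve (weight_ge0 H b Sy) hb0 p (ltW s0) (or_introl a0).
  have hl : h < 1 by move: hp; rewrite a0; lra.
  exists h; first by rewrite h0.
  rewrite ctime0 add0r in e; rewrite -e; apply: flow_along => //; first by rewrite h0.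
  by apply: (not_crit_lt1 H) => //; rewrite h0.
have below t : f (Phi t (G b y 0)) <> (end_index b y)%:R.
  have l0 := oriented_level b Sy hb0; have l1 := oriented_level b Sy hb.
  rewrite level_end// in l1.
  move=> e; case: (along t) => [e'|[l|[h hh e']]].
  - by rewrite e' in e; rewrite e in l0; lra.
  - by rewrite e in l; lra.
  - have hh' : 0 <= h <= 1 by case/andP: hh => ? ?; lra.
    rewrite e' in e; have := oriented_level b Sy hh'; rewrite e.
    by case/andP: hh => ? ?; lra.
have empt : Defs.orbit Phi (G b y 0) `&` Xlevel X f c (end_index b y) = set0.
  apply/seteqP; split=> // x [[t _ <-] [_ e]].
  exact: (below t).
have cG := @continuous_strand b _ Sy.
apply: xget_unique.
  split=> //; right; split=> // W nW.
  have /subspace_continuousP cG1 := cG.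
  have := cG1 1 _ W nW; rewrite /= in_itv /= hb => /(_ isT).
  rewrite /nbhs /= /within /= => /nbhs_ballP[e /= e0 he].
  (* A height below [1] at distance less than [e] from it; the maximum with [0] takes care of large
     [e]. *)
  pose h := Num.max 0 (1 - e / 2).
  have h0 : 0 <= h by rewrite /h le_max lexx.
  have h1 : h < 1 by rewrite /h gt_max ltr01 /=; lra.
  exists (G b y h); split.
    exists (- (orient b * ctime (a b y) h)) => //; apply: flow_along => //.
      by rewrite h0 ltW.
    by apply: (not_crit_lt1 H) => //; rewrite h0.
  apply: he; last by rewrite in_itv /= h0 ltW.
  rewrite /ball /= ger0_norm; last by lra.
  have : 1 - e / 2 <= h by rewrite /h le_max lexx orbT.
  lra.
move=> x [[Xx fx]] [[t _ e]|[_ clx]].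
  by case: (below t); rewrite e.
(* [K1] contains the orbit beyond the middle level, [K2] is the half-strand with its end. Their
   union is closed, so it contains the limit point [x]. *)
pose K1 := X `&` (fun x => orient b * f x) @^-1` [set r | r <= orient b * f (G b y 0)].
have cK1 : compact K1.
  apply: compact_preimage => //; apply: within_mul; first exact: within_cst.
  by have [] := level_tame_cont chain_C space_C.
pose K2 := G b y @` `[0, 1].
have cK2 : compact K2 by apply: continuous_compact => //; exact: segment_compact.
have clK : closed (K1 `|` K2).
  by apply: compact_closed; [exact: norm_hausdorff|exact: compactU].
have sub : Defs.orbit Phi (G b y 0) `<=` K1 `|` K2.
  move=> _ [t _ <-]; case: (along t) => [->|[l|[h hh ->]]].
  - by left; split=> //=; exact: lexx.
  - by left; split=> //; exact: (flow_X H).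
  - by right; exists h => //=; rewrite in_itv /=; case/andP: hh => -> /ltW ->.
have : (K1 `|` K2) x.
  by apply: clK => W /clx[z [/sub Kz Wz]]; exists z.
have l0 := oriented_level b Sy hb0; have l1 := oriented_level b Sy hb.
rewrite level_end// in l1.
case=> [[_ /= l]|[h /=]]; first by rewrite fx in l; exfalso; lra.
rewrite in_itv /= => hh e; have := oriented_level b Sy hh; rewrite e fx => l.
have h1 : h = 1 by lra.
by rewrite -e h1.
Qed.

Lemma level_proj_strand b y : S y ->
  level_proj X Phi f c (end_index b y) (G b y 0) = G b y 1.
Proof.
by move=> Sy; have [cy|ncy] := pselect (crit q (G b y 1));
  [exact: level_proj_limit|exact: level_proj_finite].
Qed.

(** Off the locus the middle level is met after time [(wplus x)^-1], and strict decrease makes the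
    admissible times the interval up to it. At a critical point all positive times are admissible,
    and the supremum [+oo] has inverse [0]. *)
Lemma flow_wplusE i (x : 'rV_(xdim C i)) : (i <= n)%N -> Xset i x ->
  flow_wplus Phi f c i (q (Base x)) = wplus x.
Proof.
move=> ni Xx; have [w0 wz] := wplusP chain_C ni Xx.
(* The convention at index [0] agrees with the chain: [Ysp C 0] is empty, so all of [Xsp C 0] lies
   in the locus and the given weight vanishes there. *)
rewrite /flow_wplus; case: eqP => [i0|i0].
  subst i; apply/esym/wz; apply: contrapT => nL.
  by have [y /(empty_bottom chain_C)] := rho_onto chain_C ni Xx nL.
case: i i0 ni x Xx w0 wz => // i _ ni x Xx w0 wz.
have [Lx|nL] := pselect (Lset i.+1 x).
  rewrite (wz.2 Lx) /Tplus ereal_sup_pos ?invey// => t t0; split=> //.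
  rewrite /chain_flow (flow_crit H); last by apply/(crit_Base chain_C space_C ni Xx).
  by rewrite level_Base// dlevelE; have := @natr1 R i; lra.
have [y Yy e] := rho_onto chain_C ni Xx nL.
have Sy : S (existT _ i y) by [].
have ex : q (Base x) = G true (existT _ i y) 1 by rewrite (strand_pt1 chain_C space_C)//= e.
have hb : 0 <= (1 : R) <= 1 by lra.
have nc : ~ crit q (G true (existT _ i y) 1).
  by rewrite -ex (crit_Base chain_C space_C).
have wp : 0 < wplus x.
  by rewrite lt_neqAle w0 andbT eq_sym; apply/eqP => /wz.
have eb := flow_back Sy hb nc; have ew : a true (existT _ i y) = wplus x by rewrite -e.
rewrite ctime1 /orient mul1r ew in eb.
rewrite /Tplus (@ereal_sup_itv0 _ (wplus x)^-1).
- by rewrite fine_invr invrK.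
- by rewrite invr_gt0.
move=> t; rewrite ex dlevelE -(level_mid true Sy) -eb.
split=> -[t0 tl]; split=> //.
  rewrite leNgt; apply/negP => l.
  have := level_decreasing (strand_X true Sy hb) nc l; lra.
move: tl; rewrite le_eqVlt => /orP[/eqP->//|l].
exact: ltW (level_decreasing (strand_X true Sy hb) nc l).
Qed.

Lemma flow_wminusE i (x : 'rV_(xdim C i)) : (i <= n)%N -> Xset i x ->
  flow_wminus Phi f n c i (q (Base x)) = wminus x.
Proof.
move=> ni Xx; have [w0 wz] := wminusP chain_C ni Xx.
(* Likewise at the top index, where [Ysp C (len C).+1] is empty. *)
rewrite /flow_wminus; case: eqP => [i0|i0].
  apply/esym/wz; apply: contrapT => nL.
  have [y Yy _] := lam_onto chain_C ni Xx nL.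
  by have := strand_lt chain_C ni Yy; rewrite i0 ltnn.
have [Lx|nL] := pselect (Lset i x).
  rewrite (wz.2 Lx) /Tminus ereal_sup_pos ?invey// => t t0; split=> //.
  rewrite /chain_flow (flow_crit H); last by apply/(crit_Base chain_C space_C ni Xx).
  by rewrite level_Base// dlevelE; lra.
have [y Yy e] := lam_onto chain_C ni Xx nL.
have Sy : S (existT _ i y) by split=> //=; exact: (strand_lt chain_C ni Yy).
have ex : q (Base x) = G false (existT _ i y) 1 by rewrite (strand_pt1 chain_C space_C)//= e.
have hb : 0 <= (1 : R) <= 1 by lra.
have nc : ~ crit q (G false (existT _ i y) 1).
  by rewrite -ex (crit_Base chain_C space_C).
have wp : 0 < wminus x.
  by rewrite lt_neqAle w0 andbT eq_sym; apply/eqP => /wz.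
have eb := flow_back Sy hb nc; have ew : a false (existT _ i y) = wminus x by rewrite -e.
rewrite ctime1 /orient mulN1r ew in eb.
rewrite /Tminus (@ereal_sup_itv0 _ (wminus x)^-1).
- by rewrite fine_invr invrK.
- by rewrite invr_gt0.
move=> t; rewrite ex dlevelE -(level_mid false Sy) -eb.
split=> -[t0 tl]; split=> //.
  rewrite leNgt; apply/negP => l.
  have l' : - t < - (wminus x)^-1 by rewrite ltrN2.
  have := level_decreasing (strand_X false Sy hb) nc l'; lra.
move: tl; rewrite le_eqVlt => /orP[/eqP->//|l].
have l' : - (wminus x)^-1 < - t by rewrite ltrN2.
exact: ltW (level_decreasing (strand_X false Sy hb) nc l').
Qed.

Lemma chain_flow_iso : chain_iso (C := C) (C' := flow_chain X Phi f n c)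
  (fun i x => q (Base x)) (fun i y => q (CylRho y 0)).
Proof.
split=> // [i|i ni]; first exact: homeo_Y.
split.
- exact: homeo_X.
- exact: loc_image.
- case: i ni => [|i] ni y Yy; first by have := empty_bottom chain_C Yy.
  have Sy : S (existT _ i y) by [].
  by have := level_proj_strand true Sy; rewrite (strand_pt1 chain_C space_C).
- move=> y Yy; have Sy : S (existT _ i y) by split=> //=; exact: (strand_lt chain_C ni Yy).
  have := level_proj_strand false Sy.
  (* The isomorphism places [Ysp C i.+1] at the middle of the [CylRho] side, which [strand_mid]
     identifies with the middle of the [lam] half. *)
  by rewrite (strand_pt1 chain_C space_C)// -(strand_mid H).
- by move=> x Xx; split; [exact: flow_wplusE|exact: flow_wminusE].
Qed.


End Final.

Theorem theorem10p4 (R : realType) (N : nat) (X : set 'rV[R]_N)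
    (tame_X : tame X) (compact_X : compact X)
    (C : chain R) (chain_C : weighted_chain C)
    (q : glue_point C -> 'rV[R]_N) (space_C : associated_space X q) :
  exists (Phi : R -> 'rV[R]_N -> 'rV[R]_N) (f : 'rV[R]_N -> R) (c : nat -> R),
    [/\ Fl_grad X Phi,
        lyapunov X Phi f,
        critical_levels X Phi f (len C) c &
        chain_iso (C := C) (C' := flow_chain X Phi f (len C) c)
          (fun i x => q (Base x)) (fun i y => q (CylRho y 0%R))].
Proof.
exists (chain_flow X q), (level q), (fun i => i%:R); split.
- exact: chain_flow_Fl_grad.
- exact: chain_flow_lyapunov.
- exact: chain_flow_levels.
- exact: chain_flow_iso.
Qed.
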